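(* (i) Let $1<p<\infty$ and $\frac1p+\frac1{p'}=1$. The operator $C_1\in\mathcal{L}(\ell^p)$ has norm $\|C_1\|_{\ell^p\to\ell^p}=p'$ and spectrum $$\sigma(C_1;\ell^p)=\Big\{z\in\mathbb{C}:\ \Big|z-\frac{p'}{2}\Big|\le\frac{p'}{2}\Big\}.$$ Moreover, $C_1\in\mathcal{L}(\ell^p)$ is not compact and not power bounded and fails to be either mean ergodic or supercyclic. (ii) The operator $C_1\in\mathcal{L}(\ell^\infty)$ satisfies $\|C_1\|_{\ell^\infty\to\ell^\infty}=1$ and has spectrum $$\sigma(C_1;\ell^\infty)=\Big\{z\in\mathbb{C}:\ \Big|z-\frac12\Big|\le\frac12\Big\}.$$ Furthermore, $C_1\in\mathcal{L}(\ell^\infty)$ is not compact, not mean ergodic and fails to be supercyclic.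
   Context: Sequences are complex and indexed by $\mathbb{N}_0=\{0,1,2,\dots\}$. $C_1$ is the Cesàro operator $C_1x=\big(\frac{x_0+x_1+\dots+x_n}{n+1}\big)_{n\in\mathbb{N}_0}$. $\mathcal{L}(X)$ is the space of bounded linear operators on a Banach space $X$ and $\sigma(T;X)$ is the spectrum of $T\in\mathcal{L}(X)$. With $T_{[n]}:=\frac1n\sum_{m=1}^nT^m$, $T$ is mean ergodic if $(T_{[n]})_{n\geq 1}$ converges in the strong operator topology; $T$ is power bounded if $\sup_{n\ge1}\|T^n\|<\infty$; $T$ is supercyclic if there is $x\in X$ with $\{\lambda T^nx:\lambda\in\mathbb{C},n\in\mathbb{N}_0\}$ dense in $X$. *)

(* Defs.v *)
From HB Require Import structures.
From mathcomp Require Import all_boot all_order all_algebra.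
From mathcomp Require Import all_classical all_reals all_analysis.
From mathcomp Require Import ess_sup_inf complex.

Set Implicit Arguments.
Unset Strict Implicit.
Unset Printing Implicit Defensive.

Import Order.TTheory GRing.Theory Num.Theory.
Import numFieldNormedType.Exports.

Local Open Scope classical_set_scope.
Local Open Scope ring_scope.
Local Open Scope complex_scope.

Lemma normc_ge0 (R : realType) (z : R[i]) : 0 <= Normc.normc z.
Proof. by case: z => a b; exact: sqrtr_ge0. Qed.

Lemma normcE (R : realType) (z : R[i]) : `|z| = (Normc.normc z)%:C.
Proof. by []. Qed.

Lemma ler_normcD (R : realType) (z w : R[i]) :
  Normc.normc (z + w) <= Normc.normc z + Normc.normc w.
Proof. by have := ler_normD z w; rewrite !normcE -rmorphD lecR. Qed.

Definition ell_norm (R : realType) (p : \bar R) (x : nat -> R[i]) : \bar R :=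
  Lnorm counting p (fun n => (Normc.normc (x n))%:E).

Section ell_norm_theory.
Context {R : realType}.
Implicit Types (x y : nat -> R[i]) (p : \bar R).

Lemma ell_norm_fin (p : R) x : 0 < p ->
  (ell_norm p%:E x =
   (\sum_(0 <= n <oo) (Normc.normc (x n) `^ p)%:E) `^ p^-1)%E.
Proof.
move=> p0; rewrite /ell_norm Lnorm_counting//; congr (_ `^ _)%E.
apply: eq_eseriesr => n _.
by rewrite abse_EFin poweR_EFin ger0_norm// normc_ge0.
Qed.

Let ae_counting (P : nat -> Prop) :
  (\forall n \ae (counting : {measure set nat -> \bar R}), P n) ->
  forall n, P n.
Proof.
move=> [A [mA A0 PA]] n; apply: contrapT => nPn.
have An : A n by exact: PA.
have : (counting [set n] <= (counting A : \bar R))%E.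
  by apply: le_measure; rewrite ?inE//= => _ ->.
rewrite A0 /counting/= asboolT ?finite_set1// fset_set1 finmap.cardfs1.
by rewrite lee_fin ler10.
Qed.

Let counting_gt0 : (0 < (counting : {measure set nat -> \bar R}) setT)%E.
Proof. by rewrite /= /counting asboolF//; exact: infinite_nat. Qed.

Lemma ell_norm_infty x :
  ell_norm +oo x = ereal_sup (range (fun n => (Normc.normc (x n))%:E)).
Proof.
rewrite /ell_norm unlock /Lnorm counting_gt0; apply/eqP; rewrite eq_le.
apply/andP; split.
  apply/ess_supP/nearW => n /=; rewrite ger0_norm ?normc_ge0//.
  by apply: ereal_sup_ubound; exists n.
apply: ge_ereal_sup => _ [n _ <-].
have /ae_counting/(_ n) := ess_sup_ge (counting : {measure set nat -> \bar R})
  (abse \o (fun n => (Normc.normc (x n))%:E)).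
by rewrite /= ger0_norm// normc_ge0.
Qed.

Lemma ell_norm_ge0 p x : (0 <= ell_norm p x)%E.
Proof. exact: Lnorm_ge0. Qed.

Lemma ell_norm_eq0 p x : (1 <= p)%E -> ell_norm p x = 0 -> x = 0.
Proof.
move=> p1 /Lnorm_eq0_eq0; have p0 : (0 < p)%E by exact: lt_le_trans p1.
move=> /(_ (fun _ _ _ => I) p0)/ae_counting x0; apply/funext => n.
by have /= [] := x0 n I; exact: Normc.eq0_normc.
Qed.

Lemma ell_normZ p (a : R[i]) x : (1 <= p)%E ->
  ell_norm p (a *: x)%R = ((Normc.normc a)%:E * ell_norm p x)%E.
Proof.
case: p => [p| |]//; last first.
  move=> _; rewrite /ell_norm unlock /Lnorm counting_gt0.
  rewrite -ess_supZl ?normc_ge0//; congr ess_sup; apply/funext => n /=.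
  by rewrite Normc.normcM !ger0_norm ?mulr_ge0 ?normc_ge0// EFinM.
rewrite lee_fin => p1; have p0 : 0 < p by exact: lt_le_trans p1.
rewrite !ell_norm_fin//.
under eq_eseriesr do
  rewrite Normc.normcM powRM ?normc_ge0// EFinM.
rewrite nneseriesZl//; last by move=> n _; rewrite lee_fin powR_ge0.
rewrite poweRM ?nneseries_ge0// ?lee_fin ?powR_ge0//.
  by rewrite poweR_EFin -powRrM mulfV ?gt_eqF// powRr1 ?normc_ge0.
by move=> n _ _; rewrite lee_fin powR_ge0.
Qed.

Lemma ler_ell_normD p x y : (1 <= p)%E ->
  (ell_norm p (x + y)%R <= ell_norm p x + ell_norm p y)%E.
Proof.
move=> p1.
pose h n := Normc.normc (x n) + Normc.normc (y n).
have h0 n : 0 <= h n by rewrite addr_ge0 ?normc_ge0.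
apply: (@le_trans _ _ (Lnorm (counting : {measure set nat -> \bar R}) p
    (EFin \o h))); last exact: eminkowski.
case: p p1 => [p| |]//; last first.
  move=> _; rewrite /ell_norm unlock /Lnorm counting_gt0.
  apply: le_ess_sup; apply: nearW => n /=.
  by rewrite lee_fin !ger0_norm ?normc_ge0 ?ler_normcD.
rewrite lee_fin => p1; have p0 : 0 < p by exact: lt_le_trans p1.
rewrite ell_norm_fin// Lnorm_counting//.
apply: gt0_ler_poweR; rewrite ?invr_ge0 ?(ltW p0)// ?in_itv/= ?leey ?andbT.
- by apply: nneseries_ge0 => n _ _; rewrite lee_fin powR_ge0.
- by apply: nneseries_ge0 => n _ _; rewrite lee_fin powR_ge0.
apply: lee_nneseries => [n _ _|n _]; first by rewrite lee_fin powR_ge0.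
rewrite /= lee_fin ge0_ler_powR ?nnegrE ?normc_ge0// ?(ltW p0)//.
by rewrite ger0_norm// ler_normcD.
Qed.

End ell_norm_theory.

Section ell_type.
Context {R : realType} (p : \bar R) (p1 : (1 <= p)%E).

Definition ell_pred of (1 <= p)%E : {pred nat -> R[i]} :=
  [pred x | (ell_norm p x < +oo)%E].

Record ell := Ell {
  ell_seq :> nat -> R[i];
  ell_seqP : ell_seq \in ell_pred p1 }.

HB.instance Definition _ := [isSub for ell_seq].
HB.instance Definition _ := [Choice of ell by <:].

Lemma ell_submod_closed : submod_closed (ell_pred p1).
Proof.
split=> [|a x y]; rewrite !inE.
  rewrite -(scale0r (0 : nat -> R[i])) ell_normZ// Normc.normc0.
  by rewrite mul0e ltry.
move=> xlty ylty; apply: le_lt_trans (ler_ell_normD _ _ p1) _.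
by rewrite lte_add_pinfty// ell_normZ// lte_mul_pinfty// ?lee_fin ?normc_ge0.
Qed.

HB.instance Definition _ := GRing.isSubmodClosed.Build R[i] (nat -> R[i])
  (ell_pred p1) ell_submod_closed.
HB.instance Definition _ := [SubChoice_isSubLmodule of ell by <:].

Implicit Types x y : ell.

Let ell_norm_fin_num x : ell_norm p x \is a fin_num.
Proof. by rewrite ge0_fin_numE ?ell_norm_ge0//; exact: ell_seqP. Qed.

(* Norms of a normed module over R[i] take their values in R[i]. *)
Definition ell_normc x : R[i] := (fine (ell_norm p x))%:C.

Let ell_normcD x y : ell_normc (x + y) <= ell_normc x + ell_normc y.
Proof.
rewrite /ell_normc -rmorphD lecR -fineD// fine_le ?fin_numD ?ell_norm_fin_num//.
exact: ler_ell_normD.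
Qed.

Let ell_normcZ (a : R[i]) x : ell_normc (a *: x) = `|a| * ell_normc x.
Proof.
rewrite normcE /ell_normc -rmorphM.
by rewrite (_ : (a *: x : ell) = a *: (x : nat -> R[i]) :> (nat -> R[i]))//
  ell_normZ// fineM.
Qed.

Let ell_normc_eq0 x : ell_normc x = 0 -> x = 0.
Proof.
move=> [x0].
apply/val_inj/(ell_norm_eq0 p1).
by rewrite -(fineK (ell_norm_fin_num x)) x0.
Qed.

HB.instance Definition _ :=
  Lmodule_isNormed.Build R[i] ell ell_normcD ell_normcZ ell_normc_eq0.

Lemma ell_normE x : `|x| = (fine (ell_norm p x))%:C.
Proof. by []. Qed.

End ell_type.

Section operators.
Context {R : realType} {X : normedModType R[i]}.
Implicit Types (T S P : X -> X) (z : R[i]).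

Definition bounded_linear T := linear T /\ continuous T.

Definition op_norm T : \bar R :=
  ereal_sup [set (complex.Re `|T x|)%:E | x in [set x : X | `|x| <= 1]].

Definition resolvent_set T : set R[i] :=
  [set z | exists S, [/\ bounded_linear S,
     forall x, S (z *: x - T x) = x & forall x, z *: S x - T (S x) = x]].

Definition spectrum T : set R[i] := ~` resolvent_set T.

Definition compact_operator T :=
  compact (closure (T @` [set x : X | `|x| <= 1])).

Definition power_bounded T : Prop :=
  (ereal_sup [set op_norm (iter n T) | n in [set n | (1 <= n)%N]] < +oo)%E.

(* Only the terms with index n >= 1 are meaningful; the term of index 0 is 0. *)
Definition ergodic_mean T (n : nat) (x : X) : X :=
  n%:R^-1 *: \sum_(1 <= m < n.+1) iter m T x.

Definition mean_ergodic T :=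
  exists P, bounded_linear P /\
    forall x, (fun n => ergodic_mean T n x) @ \oo --> P x.

Definition supercyclic T :=
  exists x : X, dense [set y | exists z n, y = z *: iter n T x].

End operators.

Definition cesaro_seq (R : realType) (x : nat -> R[i]) (n : nat) : R[i] :=
  (\sum_(k < n.+1) x k) / n.+1%:R.

Lemma exponent_ge1 (R : realType) (p : R) : 1 < p -> (1 <= p%:E)%E.
Proof. by move=> /ltW; rewrite lee_fin. Qed.

(* Main.v *)
(* Put s = 1/p (s = 0 for p = oo), A = C_1 x and w = 1/z.  Then
   (n+1) A_n = n A_(n-1) + x_n, and z x - C_1 x = b is equivalent to
   (n+1-w) A_n = n A_(n-1) + w b_n together with x = w (A + b).  Multiplying
   (n+1-al) u_n <= n u_(n-1) + b_n by u_n^(p-1) and using Young's inequality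
   gives |u|_p <= |b|_p / (1-s-al) as soon as al < 1-s.  With al = 0 this is
   Hardy's inequality with the sharp constant p'; with al = Re w it bounds the
   resolvent when Re w < 1-s, i.e. outside the disc |z - p'/2| <= p'/2.
   Inside the closed disc the recursion is solved explicitly: for b = e_0
   (p finite) or b aligned in phase with A (p = oo) the solution A is not in
   l^p; if w = m+1 then e_m is not in the range, and if z = 0 the inverse
   would map e_m to a vector of norm at least m+1.
   For p finite and a slightly larger than 1/p' the weight (n+1)^(-a) is in
   l^(p') and is a supersolution of the transposed eigenvalue equation with
   eigenvalue 1/a, so |C_1^j e_0| >= c a^(-j): this gives the lower bound of
   the norm and excludes power boundedness and mean ergodicity. *)
From HB Require Import structures.
Require Import Defs.
From mathcomp Require Import all_boot all_order all_algebra.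
From mathcomp Require Import all_classical all_reals all_analysis.
From mathcomp Require Import complex.
From mathcomp Require Import ring lra.

Import Order.TTheory GRing.Theory Num.Theory.
Import numFieldNormedType.Exports.

Local Open Scope classical_set_scope.
Local Open Scope ring_scope.
Local Open Scope complex_scope.

(** * Weighted recursions for real sequences *)

Section real_sequences.
Set Implicit Arguments.
Unset Strict Implicit.
Context {R : realType}.
Implicit Types (u b z : nat -> R).

(** Young's inequality for the exponents p and p', applied to a and b^(p-1): the p'-th power of
    b^(p-1) is b^p. *)
Lemma young_powRB1 (p a b : R) : 1 < p -> 0 <= a -> 0 <= b ->
  a * b `^ (p - 1) <= a `^ p / p + b `^ p * (1 - p^-1).
Proof.
move=> p1 a0 b0; have p0 : 0 < p by exact: lt_trans p1.
have s1 : p^-1 < 1 by rewrite invf_lt1.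
have := @conjugate_powR R a (b `^ (p - 1)) p (1 - p^-1)^-1 a0 (powR_ge0 _ _) p0.
rewrite invr_gt0 subr_gt0 invrK -powRrM => /(_ s1).
rewrite subrKC => /(_ erefl).
rewrite (_ : (p - 1) * (1 - p^-1)^-1 = p)//.
have -> : 1 - p^-1 = (p - 1) / p by rewrite mulrBl divff ?gt_eqF// mul1r.
by rewrite invfM invrK mulrA divff ?mul1r// subr_eq0 gt_eqF.
Qed.

(** Bernoulli's inequality for exponents in [0, 1], obtained from Young's inequality for (1+t)^r and
    1 with exponents 1/r and 1/(1-r). *)
Lemma powR1D_le (r t : R) : 0 <= r <= 1 -> -1 <= t ->
  (1 + t) `^ r <= 1 + r * t.
Proof.
move=> /andP[]; rewrite le_eqVlt => /predU1P[<-|r0].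
  by rewrite powRr0 mul0r addr0.
rewrite le_eqVlt => /predU1P[->|r1] t1.
  by rewrite powRr1 ?mul1r// addrC -lerBlDr sub0r.
have t0 : 0 <= 1 + t by rewrite addrC -lerBlDr sub0r.
have := @conjugate_powR R ((1 + t) `^ r) 1 r^-1 (1 - r)^-1 (powR_ge0 _ _) ler01.
rewrite !invr_gt0 subr_gt0 !invrK subrKC => /(_ r0 r1 erefl).
rewrite mulr1 -powRrM mulfV ?gt_eqF// powRr1// powR1.
by move=> /le_trans; apply; rewrite le_eqVlt; apply/orP; left; apply/eqP; ring.
Qed.

(** When 1 - a t > 0, Bernoulli gives (1 - a t)(1+t)^a <= (1 - a t)(1 + a t) <= 1. *)
Lemma powRN_ratio_ge (a t : R) : 0 <= a <= 1 -> -1 < t ->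
  1 - a * t <= (1 + t) `^ (- a).
Proof.
move=> a01 t1; rewrite powRN.
have [|at1] := leP (1 - a * t) 0.
  by move=> /le_trans; apply; rewrite invr_ge0 powR_ge0.
have P0 : 0 < (1 + t) `^ a by rewrite powR_gt0// addrC -ltrBlDr sub0r.
rewrite -div1r ler_pdivlMr//.
apply: le_trans (ler_wpM2l (ltW at1) (powR1D_le a01 (ltW t1))) _.
have := sqr_ge0 (a * t); nra.
Qed.

(** This and [powRN_sub_ge] replace the mean value theorem for x^(-a); they are [powRN_ratio_ge] at
    t = 1/(n+1) and at t = -1/(n+2). *)
Lemma powRN_sub_le (a : R) n : 0 <= a <= 1 ->
  n.+1%:R `^ (- a) - n.+2%:R `^ (- a) <= a * (n.+1%:R `^ (- a) / n.+1%:R).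
Proof.
move=> a01; have n0 : 0 < n.+1%:R :> R by [].
have -> : n.+2%:R = n.+1%:R * (1 + n.+1%:R^-1) :> R.
  by rewrite mulrDr mulr1 divff ?gt_eqF// natr1.
have i0 : 0 < n.+1%:R^-1 :> R by rewrite invr_gt0.
rewrite powRM ?addr_ge0 ?ler0n ?(ltW i0)//.
have K := @powRN_ratio_ge a n.+1%:R^-1 a01 (lt_trans (ltrN10 _) i0).
have := ler_wpM2l (powR_ge0 (n.+1%:R : R) (- a)) K.
set P := n.+1%:R `^ (- a); set Q := (_ + _) `^ (- a); set i := n.+1%:R^-1; lra.
Qed.

Lemma powRN_sub_ge (a : R) n : 0 <= a <= 1 ->
  a * n.+2%:R `^ (- (1 + a)) <= n.+1%:R `^ (- a) - n.+2%:R `^ (- a).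
Proof.
move=> a01; have n0 : 0 < n.+2%:R :> R by [].
have E : n.+1%:R = n.+2%:R * (1 - n.+2%:R^-1) :> R.
  by rewrite mulrBr mulr1 divff ?gt_eqF// -[n.+2%:R]natr1 addrK.
have i0 : n.+2%:R^-1 < 1 :> R by rewrite invf_lt1// ltr1n.
rewrite [in leRHS]E powRM ?ler0n//; last by rewrite subr_ge0 ltW.
have -> : n.+2%:R `^ (- (1 + a)) = n.+2%:R^-1 * n.+2%:R `^ (- a) :> R.
  by rewrite opprD powRD ?(gt_eqF n0) ?implybT// powR_inv1// ltW.
have := @powRN_ratio_ge a (- n.+2%:R^-1) a01; rewrite ltrN2 => /(_ i0) K.
have := ler_wpM2l (powR_ge0 (n.+2%:R : R) (- a)) K.
set P := n.+2%:R `^ (- a); set Q := (_ + _) `^ (- a); set i := n.+2%:R^-1; lra.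
Qed.

(** Telescoping [powRN_sub_ge] plays the part of the integral test. *)
Lemma sum_powRN_le (e : R) N : 0 < e <= 1 ->
  \sum_(n < N) n.+1%:R `^ (- (1 + e)) <= 1 + e^-1.
Proof.
move=> /andP[e0 e1]; case: N => [|N].
  by rewrite big_ord0 addr_ge0// invr_ge0 ltW.
suff: e * \sum_(n < N.+1) n.+1%:R `^ (- (1 + e)) <=
    e + 1 - N.+1%:R `^ (- e).
  move=> H; rewrite -(ler_pM2l e0); apply: le_trans H _.
  by rewrite mulrDr mulr1 divff ?gt_eqF// gerBl powR_ge0.
elim: N => [|N IH].
  by rewrite big_ord_recr big_ord0/= add0r !powR1 mulr1 addrK.
rewrite big_ord_recr/= mulrDr.
have := @powRN_sub_ge e N; rewrite e1 ltW// => /(_ isT).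
move: IH; lra.
Qed.

Lemma powRN_small (a e : R) : 0 < a -> 0 < e ->
  exists N, forall n, (N <= n)%N -> n.+1%:R `^ (- a) <= e.
Proof.
move=> a0 e0; exists (Num.trunc (e^-1 `^ a^-1)) => n Nn.
have H : e^-1 `^ a^-1 <= n.+1%:R.
  by apply/ltW/(lt_le_trans (truncnS_gt _)); rewrite ler_nat ltnS.
rewrite powRN -[e]invrK lef_pV2 ?posrE ?powR_gt0 ?invr_gt0//.
have := ge0_ler_powR (ltW a0) _ _ H; rewrite !nnegrE powR_ge0 ler0n => /(_ isT isT).
by rewrite -powRrM mulVf ?gt_eqF// powRr1// invr_ge0 ltW.
Qed.

Lemma harmonic_unbounded (B : R) : exists N, B < \sum_(n < N) n.+1%:R^-1.
Proof.
apply: contrapT => /forallNP H; apply: (@dvg_harmonic R).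
apply: nondecreasing_is_cvgn.
  by apply: nondecreasing_series => n _ _; rewrite /harmonic/= invr_ge0.
exists B => _ [N _ <-]; rewrite /series/= big_mkord leNgt; apply/negP; exact: H.
Qed.

(* Young's inequality turns the recursion into
   [(n+1) u_n^p + d u_n^p <= n u_(n-1)^p + d (b_n/d)^p], which telescopes. *)
Lemma sum_powR_recursion_le (p al d : R) u b : 1 < p ->
  d = 1 - p^-1 - al -> 0 < d -> (forall n, 0 <= u n) -> (forall n, 0 <= b n) ->
  (forall n, (n.+1%:R - al) * u n <= n%:R * u n.-1 + b n) ->
  forall N, \sum_(n < N) u n `^ p <= \sum_(n < N) (b n / d) `^ p.
Proof.
move=> p1 dE d0 u0 b0 H.
have p0 : 0 < p by exact: lt_trans p1.
have s0 : 0 < p^-1 by rewrite invr_gt0.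
(* At n = 0 the value [u n.-1] is harmless, here and in the later recursions: its coefficient [n%:R]
   vanishes. *)
have step n : n.+1%:R * u n `^ p + d * u n `^ p <=
    n%:R * u n.-1 `^ p + d * (b n / d) `^ p.
  have Y1 := @young_powRB1 p (u n.-1) (u n) p1 (u0 _) (u0 _).
  have Y2 := @young_powRB1 p (b n / d) (u n) p1 (divr_ge0 (b0 _) (ltW d0)) (u0 _).
  have P1 := mulr_powRB1 (u0 n) p0.
  have Y3 : (n.+1%:R - al) * u n `^ p <=
      n%:R * (u n.-1 * u n `^ (p - 1)) + d * (b n / d * u n `^ (p - 1)).
    rewrite -P1 [leLHS]mulrA.
    apply: le_trans (ler_wpM2r (powR_ge0 (u n) (p - 1)) (H n)) _.
    by rewrite le_eqVlt; apply/orP; left; apply/eqP; field; rewrite gt_eqF.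
  have Y1' := ler_wpM2l (ler0n R n) Y1.
  have Y2' := ler_wpM2l (ltW d0) Y2.
  rewrite -(ler_pM2l s0).
  have alE : al = 1 - p^-1 - d by rewrite dE; ring.
  move: Y1' Y2' Y3; rewrite alE -natr1.
  set U := u n `^ p; set V := u n.-1 `^ p; set W := (b n / d) `^ p.
  set Q := u n `^ (p - 1); set nn := n%:R; set s := p^-1.
  lra.
case=> [|N]; first by rewrite !big_ord0.
suff: d * \sum_(n < N.+1) u n `^ p + N.+1%:R * u N `^ p <=
    d * \sum_(n < N.+1) (b n / d) `^ p.
  move=> {}H; rewrite -(ler_pM2l d0); apply: le_trans H.
  by rewrite lerDl mulr_ge0// powR_ge0.
elim: N => [|N IH].
  by rewrite !big_ord1; have := step 0%N; rewrite mul0r add0r addrC.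
rewrite big_ord_recr/= [X in _ <= _ * X]big_ord_recr/= !mulrDr.
have := step N.+1; move: IH; rewrite /=; lra.
Qed.

(** The constant X = B / (1 - al) is the equilibrium: (n+1-al) X = n X + B for every n. *)
Lemma sup_recursion_le (al B : R) u b : al < 1 ->
  (forall n, b n <= B) ->
  (forall n, (n.+1%:R - al) * u n <= n%:R * u n.-1 + b n) ->
  forall n, u n <= B / (1 - al).
Proof.
move=> al1 bB H; have d0 : 0 < 1 - al by rewrite subr_gt0.
have key n : n%:R * u n.-1 <= n%:R * (B / (1 - al)) -> u n <= B / (1 - al).
  move=> IH; have m0 : 0 < n.+1%:R - al.
    by rewrite -natr1 -addrA ltr_wpDl.
  rewrite -(ler_pM2l m0); apply: le_trans (H n) _.
  apply: le_trans (lerD IH (bB n)) _.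
  rewrite -{2}[B](divfK (lt0r_neq0 d0)) -natr1.
  by rewrite le_eqVlt; apply/orP; left; apply/eqP; ring.
elim=> [|n IH]; apply: key; first by rewrite !mul0r.
by rewrite ler_wpM2l.
Qed.

Definition cesaro_real u n : R := (\sum_(k < n.+1) u k) / n.+1%:R.

Lemma cesaro_real_ge0 u : (forall n, 0 <= u n) -> forall n, 0 <= cesaro_real u n.
Proof. by move=> u0 n; rewrite divr_ge0// sumr_ge0. Qed.

(* The weight [(n+1)^(-a)] is a supersolution with eigenvalue [1/a] for the
   transpose of the Cesaro matrix. *)
Lemma dual_weight_bound (a B : R) z : 0 < a <= 1 -> (forall n, 0 <= z n) ->
  (forall N, \sum_(n < N) n.+1%:R `^ (- a) * cesaro_real z n <= B) ->
  forall M, \sum_(n < M) n.+1%:R `^ (- a) * z n <= a * B.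
Proof.
move=> /andP[a0 a1] z0 H M.
pose y n : R := n.+1%:R `^ (- a).
(* Summation by parts; the truncated weights y_k - y_N vanish at k = N, so no boundary term
   appears. *)
have abel N : \sum_(n < N) (y n - y n.+1) * \sum_(k < n.+1) z k =
    \sum_(k < N) (y k - y N) * z k.
  elim: N => [|N IH]; first by rewrite !big_ord0.
  rewrite big_ord_recr/= IH 2!big_ord_recr/= mulrDr addrA; congr (_ + _).
  by rewrite mulr_sumr -big_split/=; apply: eq_bigr => k _; ring.
have main N : (M <= N)%N -> \sum_(k < M) (y k - y N) * z k <= a * B.
  move=> MN; apply: (@le_trans _ _ (\sum_(k < N) (y k - y N) * z k)).
    rewrite (big_ord_widen N (fun k => (y k - y N) * z k) MN).
    rewrite [leRHS](bigID (fun k : 'I_N => (k < M)%N))/= lerDl sumr_ge0// => k _.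
    rewrite mulr_ge0// subr_ge0 /y !powRN lef_pV2 ?posrE ?powR_gt0//.
    rewrite ge0_ler_powR ?nnegrE ?ler0n ?ler_nat ?(ltW a0)//.
    by rewrite ltnS ltnW.
  rewrite -abel; apply: le_trans (ler_wpM2l (ltW a0) (H N)).
  rewrite mulr_sumr; apply: ler_sum => n _.
  have := @powRN_sub_le a n; rewrite a1 ltW// => /(_ isT) K.
  have S0 : 0 <= \sum_(k < n.+1) z k by rewrite sumr_ge0.
  apply: le_trans (ler_wpM2r S0 K) _.
  by rewrite /cesaro_real le_eqVlt; apply/orP; left; apply/eqP; ring.
(* M is now fixed and N grows: y_N times the sum of the first M terms becomes smaller than e. *)
apply/ler_addgt0Pr => e e0.
pose Z := \sum_(k < M) z k.
have Z0 : 0 <= Z by rewrite sumr_ge0.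
have [N HN] := @powRN_small a (e / (Z + 1)) a0 (divr_gt0 e0 (ltr_wpDl Z0 ltr01)).
have := main (maxn M N) (leq_maxl _ _).
under eq_bigr do rewrite mulrBl.
rewrite sumrB -mulr_sumr -/Z lerBlDr => /le_trans; apply; rewrite lerD2l.
apply: le_trans (ler_wpM2r Z0 (HN _ (leq_maxr _ _))) _.
rewrite -mulrA ger_pMr// mulrC ler_pdivrMr ?mul1r ?lerDl ?ler01//.
exact: ltr_wpDl.
Qed.

(** Induction keeps (n+1) u_n above a multiple of (n+2+E)^r. Without the perturbation c/(n+1) the
    power r is the natural growth rate; the shift E absorbs the perturbation. *)
Lemma growth_lower_bound (al r c : R) n1 u : 0 < r <= 1 -> r <= al -> 0 <= c ->
  (forall n, 0 < u n) ->
  (forall n, (n1 <= n)%N ->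
     n%:R * u n.-1 <= (n.+1%:R - al + c / n.+1%:R) * u n) ->
  exists K N, 0 < K /\
    forall n, (N <= n)%N -> K * n.+1%:R `^ (r - 1) <= u n.
Proof.
move=> /andP[r0 r1] ral c0 u0 H.
pose E := 2 * c / r.
have E0 : 0 <= E by rewrite divr_ge0 ?mulr_ge0// ltW.
pose z n : R := (n.+2%:R + E) `^ r.
have zE0 n : 0 < n.+2%:R + E by rewrite ltr_wpDr.
have z0 n : 0 < z n by rewrite powR_gt0.
pose N := maxn n1 (Num.trunc (E + 1)).+1.
pose K := N.+1%:R * u N / z N.
have K0 : 0 < K by rewrite divr_gt0// mulr_gt0.
exists K, N; split => //.
suff main n : (N <= n)%N -> K * z n <= n.+1%:R * u n.
  move=> n Nn; rewrite -(ler_pM2l (ltr0Sn R n)) mulrCA.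
  apply: le_trans (main _ Nn); rewrite ler_pM2l// mulr_powRB1//.
  rewrite ge0_ler_powR ?nnegrE ?(ltW r0) ?(ltW (zE0 _))//.
  by rewrite ler_wpDr// ler_nat.
elim: n => [|n IH]; first by rewrite leqn0 => /eqP <-; rewrite /K divfK ?gt_eqF.
rewrite leq_eqVlt => /predU1P[<-|]; first by rewrite /K divfK ?gt_eqF.
rewrite ltnS => Nn; have {}IH := IH Nn.
set m : R := n.+2%:R.
have m0 : 0 < m by [].
have mE : E + 1 <= m.
  apply/ltW/(lt_le_trans (truncnS_gt _)); rewrite ler_nat.
  by rewrite (leq_trans (leq_trans (leq_maxr n1 _) Nn))// -addn2 leq_addr.
have {}H : n.+1%:R * u n <= (m - al + c / m) * u n.+1.
  by apply: (H n.+1); rewrite (leq_trans (leq_trans (leq_maxl _ _) Nn)).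
have zz : z n.+1 <= (1 + r / (m + E)) * z n.
  have -> : z n.+1 = (1 + (m + E)^-1) `^ r * z n.
    rewrite /z -powRM ?(ltW (zE0 _))//; last first.
      by rewrite addr_ge0// invr_ge0 addr_ge0// ltW.
    congr (_ `^ _); rewrite mulrDl mul1r mulVf ?gt_eqF ?zE0// -/m.
    by rewrite -[n.+3%:R]natr1 -/m; ring.
  rewrite ler_wpM2r ?(ltW (z0 _))// powR1D_le ?(ltW r0)//.
  by rewrite (le_trans (lerN10 _))// invr_ge0 addr_ge0// ltW.
have mEp : 0 < m + E by rewrite ltr_wpDr.
(* Since r E = 2 c, clearing denominators leaves m (c + r^2) >= c (E + r), which holds because m >=
   E + 1. *)
have coef : (1 + r / (m + E)) * (m - r + c / m) <= m.
  have rE : r * E = 2 * c by rewrite /E mulrC divfK ?gt_eqF.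
  have -> : (1 + r / (m + E)) * (m - r + c / m) =
      ((m + E + r) * (m ^+ 2 - r * m + c)) / (m * (m + E)).
    by move: m0 mEp; move: (m) (E) => x y x0 y0; field; rewrite !gt_eqF.
  rewrite ler_pdivrMr ?mulr_gt0// -subr_ge0.
  have -> : m * (m * (m + E)) - (m + E + r) * (m ^+ 2 - r * m + c) =
     m * (r * E + r ^+ 2 - c) - c * (E + r) by ring.
  rewrite rE; have := sqr_ge0 r; nra.
have un0 := ltW (u0 n.+1).
apply: le_trans (ler_wpM2l (ltW K0) zz) _.
have f0 : 0 <= 1 + r / (m + E) by rewrite addr_ge0// divr_ge0// ltW.
rewrite mulrCA; apply: le_trans (ler_wpM2l f0 (le_trans IH H)) _.
rewrite mulrA ler_wpM2r//; apply: le_trans coef.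
by rewrite ler_wpM2l// lerD2r lerD2l lerN2.
Qed.

(** For bounded u the perturbation c/(n+1) eventually consumes at most half of d. The increments are
    then at least d / (2 (n+1)), and the harmonic series contradicts the bound B. *)
Lemma resonance_unbounded (al c d B : R) n1 u : 1 <= al -> 0 <= c -> 0 < d ->
  (forall n, 0 <= u n <= B) ->
  (forall n, (n1 <= n)%N ->
     n%:R * u n.-1 + d <= (n.+1%:R - al + c / n.+1%:R) * u n) ->
  False.
Proof.
move=> al1 c0 d0 u0 H.
pose N := maxn n1 (Num.trunc (2 * c * B / d)).+1.
have [M HM] := harmonic_unbounded (B / (d / 2) + \sum_(n < N) n.+1%:R^-1).
have d2 : 0 < d / 2 by rewrite divr_gt0.
have grow n : (N <= n)%N -> u n + d / 2 / n.+1%:R <= u n.+1.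
  move=> Nn; have := H n.+1 (leq_trans (leq_trans (leq_maxl _ _) Nn) (leqnSn _)).
  rewrite /= => {}H.
  have /andP[ul uB] := u0 n.+1.
  set m : R := n.+2%:R in H.
  have m0 : 0 < m by [].
  have cB : c / m * u n.+1 <= d / 2.
    apply: (@le_trans _ _ (c / m * B)).
      by rewrite ler_wpM2l// divr_ge0// ltW.
    have : 2 * c * B / d <= m.
      apply/ltW/(lt_le_trans (truncnS_gt _)); rewrite ler_nat.
      by rewrite (leq_trans (leq_trans (leq_maxr n1 _) Nn))// -addn2 leq_addr.
    rewrite ler_pdivrMr// => cB; rewrite mulrAC ler_pdivrMr//; lra.
  rewrite -(ler_pM2l (ltr0Sn R n)) mulrDr mulrCA divff ?gt_eqF// mulr1.
  move: H cB; rewrite /m -[n.+2%:R]natr1 -/m; nra.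
have lower k : (N <= k)%N ->
    d / 2 * (\sum_(n < k) n.+1%:R^-1 - \sum_(n < N) n.+1%:R^-1) <= u k.
  elim: k => [|k IH].
    by rewrite leqn0 => /eqP ->; rewrite subrr mulr0; case/andP: (u0 0%N).
  rewrite leq_eqVlt => /predU1P[<-|].
    by rewrite subrr mulr0; case/andP: (u0 N).
  rewrite ltnS => Nk; have := grow k Nk; have := IH Nk.
  rewrite big_ord_recr/= addrAC => I1 I2; apply: le_trans I2.
  by rewrite [leLHS]mulrDr lerD2r.
have [NM|MN] := leqP N M.
  have := lower M NM; have /andP[_] := u0 M.
  move: HM; rewrite -ltrBrDr ltr_pdivrMr//.
  lra.
have : \sum_(n < M) n.+1%:R^-1 <= \sum_(n < N) n.+1%:R^-1 :> R.
  rewrite (big_ord_widen N (fun k => k.+1%:R^-1) (ltnW MN)).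
  by rewrite [leRHS](bigID (fun k : 'I_N => (k < M)%N))/= lerDl sumr_ge0.
have : 0 <= B / (d / 2).
  by rewrite divr_ge0 ?(ltW d2)//; case/andP: (u0 0%N); exact: le_trans.
move: HM; lra.
Qed.

End real_sequences.

(** * Sequences in l^p and the resolvent recursion *)

Section ell_facts.
Set Implicit Arguments.
Unset Strict Implicit.
Context {R : realType}.
Implicit Types (u b x y : nat -> R[i]) (p : \bar R) (z w : R[i]).
Local Notation normc := Normc.normc.

Lemma Re_le_normc z : complex.Re z <= normc z.
Proof.
case: z => a c /=; apply: (le_trans (ler_norm a)).
by rewrite -sqrtr_sqr ler_wsqrtr// lerDl sqr_ge0.
Qed.

Lemma normcR (r : R) : normc r%:C = `|r|.
Proof. by rewrite /= expr0n addr0 sqrtr_sqr. Qed.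

Lemma normc_nat n : normc (n%:R : R[i]) = n%:R.
Proof. by rewrite -(rmorph_nat (@real_complex R)) normcR ger0_norm. Qed.

Definition inv_exponent p : R := if p is r%:E%E then r^-1 else 0.

(** Turns a norm bound into bounds on finite real sums, the form in which all the estimates are
    proved. *)
Lemma ell_norm_le_fin (r B : R) x : 0 < r -> 0 <= B ->
  (ell_norm r%:E x <= B%:E)%E <->
  forall N, \sum_(n < N) normc (x n) `^ r <= B `^ r.
Proof.
move=> r0 B0; rewrite ell_norm_fin//.
set S := (\sum_(0 <= n <oo) _)%E.
have S0 : (0 <= S)%E by apply: nneseries_ge0 => n _ _; rewrite lee_fin powR_ge0.
have SN N : (\sum_(0 <= n < N) (normc (x n) `^ r)%:E)%E =
    (\sum_(n < N) normc (x n) `^ r)%:E by rewrite sumEFin big_mkord.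
have -> : (S `^ r^-1 <= B%:E)%E = (S <= (B `^ r)%:E)%E.
  have iff (a c : \bar R) t : (0 < t)%R -> (0 <= a)%E -> (0 <= c)%E ->
      (a <= c)%E -> (a `^ t <= c `^ t)%E.
    move=> t0 a0 c0; apply: gt0_ler_poweR; rewrite ?(ltW t0)//.
      by rewrite in_itv/= a0 leey.
    by rewrite in_itv/= c0 leey.
  apply/idP/idP => H.
    rewrite -poweR_EFin.
    have := iff _ _ r r0 (poweR_ge0 _ _) _ H; rewrite lee_fin => /(_ B0).
    by rewrite -poweRrM mulVf ?gt_eqF// poweRe1.
  have := iff _ _ r^-1 _ S0 _ H; rewrite invr_gt0 lee_fin powR_ge0.
  by move=> /(_ r0 isT); rewrite poweR_EFin -powRrM mulfV ?gt_eqF// powRr1.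
split => [H N|H].
  rewrite -lee_fin -SN; apply: le_trans H.
  by apply: nneseries_lim_ge => n _ _; rewrite lee_fin powR_ge0.
apply: lime_le.
  by apply: is_cvg_nneseries => n _ _; rewrite lee_fin powR_ge0.
by apply: nearW => N /=; rewrite SN lee_fin.
Qed.

Lemma ell_norm_le_infty (B : R) x :
  (ell_norm +oo x <= B%:E)%E <-> forall n, normc (x n) <= B.
Proof.
rewrite ell_norm_infty; split => [H n|H].
  by rewrite -lee_fin; apply: le_trans H; apply: ereal_sup_ubound; exists n.
by apply: ge_ereal_sup => _ [n _ <-]; rewrite lee_fin.
Qed.

Lemma normc_coord_le p x (B : R) n : (1 <= p)%E -> 0 <= B ->
  (ell_norm p x <= B%:E)%E -> normc (x n) <= B.
Proof.
case: p => [r| |]// r1 B0; last by move/ell_norm_le_infty.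
have r0 : 0 < r by move: r1; rewrite lee_fin; exact: lt_le_trans.
move/(ell_norm_le_fin _ r0 B0)/(_ n.+1); rewrite big_ord_recr/= => H.
have : normc (x n) `^ r <= B `^ r.
  by apply: le_trans H; rewrite lerDr sumr_ge0// => i _; rewrite powR_ge0.
rewrite leNgt => Hn; rewrite leNgt; apply: contra Hn => Hn.
by rewrite gt0_ltr_powR// nnegrE// normc_ge0.
Qed.

Lemma ell_norm_delta_le p m : (1 <= p)%E ->
  (ell_norm p (fun n => (n == m)%:R : R[i]) <= 1)%E.
Proof.
case: p => [r| |]// r1; last first.
  by apply/ell_norm_le_infty => n; rewrite normc_nat lern1 leq_b1.
have r0 : 0 < r by move: r1; rewrite lee_fin; exact: lt_le_trans.
apply/(ell_norm_le_fin _ r0 ler01) => N; rewrite powR1.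
under eq_bigr => n _ do rewrite normc_nat.
have [mN|Nm] := ltnP m N.
  rewrite (bigD1 (Ordinal mN))//= eqxx powR1 big1 ?addr0// => i.
  by rewrite -val_eqE/= => /negbTE ->; rewrite powR0// gt_eqF.
rewrite big1 ?ler01// => i _.
by rewrite (ltn_eqF (leq_trans (ltn_ord i) Nm)) powR0// gt_eqF.
Qed.

(** Joins the finite and infinite exponents, so that the boundedness of C_1 and of its resolvent
    need no case distinction on p. *)
Lemma ell_norm_recursion_le p (al D : R) u b : (1 < p)%E ->
  0 < 1 - inv_exponent p - al -> 0 <= D ->
  (forall n, (n.+1%:R - al) * normc (u n) <=
     n%:R * normc (u n.-1) + normc (b n)) ->
  (ell_norm p b <= D%:E)%E ->
  (ell_norm p u <= (D / (1 - inv_exponent p - al))%:E)%E.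
Proof.
case: p => [r| |]//=; last first.
  rewrite subr0 => _ d0 D0 H /ell_norm_le_infty bD; apply/ell_norm_le_infty.
  by apply: (sup_recursion_le (b := fun n => normc (b n))); rewrite // -subr_gt0.
rewrite lte_fin => r1 d0 D0 H.
have r0 : 0 < r by exact: lt_trans r1.
move=> /(ell_norm_le_fin _ r0 D0) bD.
apply/(ell_norm_le_fin _ r0 (divr_ge0 D0 (ltW d0))) => N.
apply: le_trans (sum_powR_recursion_le (b := fun n => normc (b n)) r1 erefl d0
  (fun n => normc_ge0 (u n)) (fun n => normc_ge0 (b n)) H N) _.
rewrite powRM ?invr_ge0 ?(ltW d0)//.
under eq_bigr => n _ do rewrite powRM ?invr_ge0 ?(ltW d0) ?normc_ge0//.
by rewrite -mulr_suml ler_wpM2r ?powR_ge0.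
Qed.

(** The identities between [cesaro_seq] and [resolvent_seq] follow from this uniqueness: both sides
    solve one recursion. *)
Lemma recursion_inj (d e u v : nat -> R[i]) : (forall n, d n != 0) ->
  (forall n, d n * u n = n%:R * u n.-1 + e n) ->
  (forall n, d n * v n = n%:R * v n.-1 + e n) -> u = v.
Proof.
move=> d0 Hu Hv; apply/funext; elim=> [|n IH].
  by apply: (mulfI (d0 0%N)); rewrite Hu Hv !mul0r.
by apply: (mulfI (d0 n.+1)); rewrite Hu Hv/= IH.
Qed.

Lemma cesaro_seqS x n :
  n.+1%:R * cesaro_seq x n = n%:R * cesaro_seq x n.-1 + x n.
Proof.
rewrite /cesaro_seq mulrC divfK ?pnatr_eq0// big_ord_recr/=; congr (_ + _).
case: n => [|n]; first by rewrite big_ord0 mul0r.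
by rewrite mulrC divfK// pnatr_eq0.
Qed.

Lemma cesaro_seq_linear (a : R[i]) x y :
  cesaro_seq (a *: x + y) = a *: cesaro_seq x + cesaro_seq y.
Proof.
apply/funext => n; rewrite /cesaro_seq.
have -> : (a *: x + y) = (fun k => a * x k + y k) by [].
rewrite big_split/= -mulr_sumr mulrDl -mulrA.
by [].
Qed.

Lemma cesaro_ell_norm_le p (D : R) x : (1 < p)%E -> inv_exponent p < 1 ->
  0 <= D -> (ell_norm p x <= D%:E)%E ->
  (ell_norm p (cesaro_seq x) <= (D / (1 - inv_exponent p))%:E)%E.
Proof.
move=> p1 s1 D0 xD; rewrite -[1 - _]subr0.
apply: (ell_norm_recursion_le (b := x)); rewrite ?subr0 ?subr_gt0// => n.
rewrite subr0 -{1}normc_nat -Normc.normcM cesaro_seqS.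
by rewrite (le_trans (ler_normcD _ _))// Normc.normcM normc_nat.
Qed.

(** This is A = C_1 x, not the preimage x of b itself; the latter is w (b + A) with w = 1/z. *)
Fixpoint resolvent_seq w b n : R[i] :=
  if n is m.+1 then (n%:R * resolvent_seq w b m + w * b n) / (n.+1%:R - w)
  else w * b 0%N / (1 - w).

Section resolvent.
Variable w : R[i].
Hypothesis wn : forall n, n.+1%:R - w != 0.

Lemma resolvent_seqS b n : (n.+1%:R - w) * resolvent_seq w b n =
  n%:R * resolvent_seq w b n.-1 + w * b n.
Proof.
case: n => [|n] /=; rewrite ?mul0r ?add0r mulrC divfK//; exact: (wn 0).
Qed.

Lemma resolvent_seq_linear (a : R[i]) x y :
  resolvent_seq w (a *: x + y) = a *: resolvent_seq w x + resolvent_seq w y.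
Proof.
apply: (recursion_inj (d := fun n => n.+1%:R - w)) => // n.
  exact: resolvent_seqS.
change ((n.+1%:R - w) * (a * resolvent_seq w x n + resolvent_seq w y n) =
  n%:R * (a * resolvent_seq w x n.-1 + resolvent_seq w y n.-1) +
  w * (a * x n + y n)).
rewrite mulrDr mulrCA !resolvent_seqS; ring.
Qed.

(** For x = w (b + A) it gives z x - C_1 x = (b + A) - A = b, the right inverse;
    [resolvent_cesaro_seq] gives the left inverse. *)
Lemma cesaro_resolvent_seq b :
  cesaro_seq (w *: (b + resolvent_seq w b)) = resolvent_seq w b.
Proof.
apply: (recursion_inj (d := fun n => n.+1%:R)
  (e := w *: (b + resolvent_seq w b))) => [n|n|n]; first by rewrite pnatr_eq0.
  exact: cesaro_seqS.
change (n.+1%:R * resolvent_seq w b n = n%:R * resolvent_seq w b n.-1 +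
  w * (b n + resolvent_seq w b n)).
by rewrite mulrDr addrA -resolvent_seqS; ring.
Qed.

Lemma resolvent_cesaro_seq x : w != 0 ->
  resolvent_seq w (w^-1 *: x - cesaro_seq x) = cesaro_seq x.
Proof.
move=> w0; apply: (recursion_inj (d := fun n => n.+1%:R - w)
  (e := w *: (w^-1 *: x - cesaro_seq x))) => // n.
  exact: resolvent_seqS.
rewrite mulrBl cesaro_seqS -addrA; congr (_ + _).
change (x n - w * cesaro_seq x n = w * (w^-1 * x n - cesaro_seq x n)).
by rewrite mulrBr mulVKf.
Qed.

End resolvent.

Lemma natrB_neq0 w n : complex.Re w < 1 -> n.+1%:R - w != 0.
Proof.
move=> w1; rewrite subr_eq0; apply: contraTneq w1 => <-.
by rewrite -(rmorph_nat (@real_complex R)) /= -leNgt ler1n.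
Qed.

(** The modulus |n+1-w| is at least its real part n+1-Re w, so the real recursion applies with al =
    Re w. *)
Lemma resolvent_ell_norm_le p (D : R) w b : (1 < p)%E ->
  0 <= inv_exponent p -> complex.Re w < 1 - inv_exponent p -> 0 <= D ->
  (ell_norm p b <= D%:E)%E ->
  (ell_norm p (resolvent_seq w b) <=
     (normc w * D / (1 - inv_exponent p - complex.Re w))%:E)%E.
Proof.
move=> p1 s0 wp D0 bD.
have w1 : complex.Re w < 1 by apply: lt_le_trans wp _; rewrite gerBl.
apply: (ell_norm_recursion_le (b := w *: b));
  rewrite ?subr_gt0 ?mulr_ge0 ?normc_ge0//.
  move=> n; apply: (@le_trans _ _ (normc ((n.+1%:R - w) * resolvent_seq w b n))).
    rewrite Normc.normcM ler_wpM2r ?normc_ge0//.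
    apply: le_trans (Re_le_normc _).
    by rewrite raddfB/= -(rmorph_nat (@real_complex R)).
  rewrite resolvent_seqS; last by move=> k; exact: natrB_neq0.
  by rewrite (le_trans (ler_normcD _ _))// Normc.normcM normc_nat.
rewrite ell_normZ ?(ltW p1)// EFinM.
by rewrite lee_wpmul2l// lee_fin normc_ge0.
Qed.

(** Inversion sends this disc to a half-plane: both conditions say |z|^2 <= r Re z. *)
Lemma disc_ReV z (r : R) : z != 0 -> 0 < r ->
  (`|z - (r / 2)%:C| <= (r / 2)%:C) = (r^-1 <= complex.Re z^-1).
Proof.
case: z => a c z0 r0; rewrite Defs.normcE lecR.
have n0 : 0 < a ^+ 2 + c ^+ 2.
  rewrite lt_neqAle addr_ge0 ?sqr_ge0// andbT eq_sym.
  by rewrite paddr_eq0 ?sqr_ge0// !sqrf_eq0; move: z0; rewrite eq_complex.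
have -> : complex.Re (a +i* c)^-1 = a / (a ^+ 2 + c ^+ 2) by [].
rewrite [RHS]ler_pdivlMr// [RHS]ler_pdivrMl//.
have h0 : 0 <= r / 2 by rewrite divr_ge0// ltW.
rewrite /= subr0 -[X in (_ <= X) = _](ger0_norm h0) -sqrtr_sqr.
rewrite ler_sqrt ?sqr_ge0//.
by apply/idP/idP; nra.
Qed.

End ell_facts.

(** * Real-valued norms and operator bounds over the complex field *)

Section complex_normed_modules.
Set Implicit Arguments.
Unset Strict Implicit.
Context {R : realType} {X : normedModType R[i]}.
Implicit Types (T : X -> X) (x y : X) (B M K : R).

(** Norms here are elements of [R[i]]; taking the real part brings estimates into the ordered field
    [R]. *)
Definition rnorm x : R := complex.Re `|x|.

Lemma rnormE x : `|x| = (rnorm x)%:C.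
Proof. by rewrite /rnorm RRe_real ?normr_real. Qed.

Lemma rnorm_ge0 x : 0 <= rnorm x.
Proof. by rewrite -ler0c -rnormE normr_ge0. Qed.

Lemma ler_rnormD x y : rnorm (x + y) <= rnorm x + rnorm y.
Proof. by rewrite -lecR rmorphD/= -!rnormE ler_normD. Qed.

Lemma rnormN x : rnorm (- x) = rnorm x.
Proof. by rewrite /rnorm normrN. Qed.

Lemma rnormZ (z : R[i]) x : rnorm (z *: x) = Normc.normc z * rnorm x.
Proof. by apply: complexI; rewrite rmorphM/= -!rnormE normrZ. Qed.

Lemma rnorm_eq0 x : rnorm x = 0 -> x = 0.
Proof. by move=> x0; apply/normr0_eq0; rewrite rnormE x0. Qed.

Lemma rnorm0 : rnorm (0 : X) = 0.
Proof. by rewrite /rnorm normr0. Qed.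

Lemma bounded_linear_of_bound T K : linear T ->
  (forall x, rnorm (T x) <= K * rnorm x) -> bounded_linear T.
Proof.
move=> lT TK; split=> //.
pose f : {linear X -> X} := HB.pack T (GRing.isLinear.Build _ _ _ _ T lT).
apply: (@bounded_linear_continuous _ _ _ f); apply/linear_boundedP.
exists K%:C; split; first by rewrite complex_real.
move=> r Kr x; apply: (@le_trans _ _ (K%:C * `|x|)).
  by rewrite !rnormE -rmorphM/= lecR TK.
by rewrite ler_wpM2r// ltW.
Qed.

Lemma bounded_linear_bound T : bounded_linear T ->
  exists K, forall x, rnorm (T x) <= K * rnorm x.
Proof.
move=> [lT cT].
pose f : {linear X -> X} := HB.pack T (GRing.isLinear.Build _ _ _ _ T lT).
have /linear_boundedP/pinfty_ex_gt0[M M0 TM] :=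
  @continuous_linear_bounded _ _ _ 0 f (cT 0).
exists (complex.Re M) => x; rewrite -lecR rmorphM/= -!rnormE.
by rewrite RRe_real ?gtr0_real//; exact: TM.
Qed.

Lemma op_norm_le T M : (forall x, rnorm x <= 1 -> rnorm (T x) <= M) ->
  (op_norm T <= M%:E)%E.
Proof.
move=> H; apply: ge_ereal_sup => _ [x x1 <-]; rewrite lee_fin; apply: H.
by move: x1; rewrite /= rnormE lecR.
Qed.

Lemma op_norm_ge T x : rnorm x <= 1 -> ((rnorm (T x))%:E <= op_norm T)%E.
Proof.
by move=> x1; apply: ereal_sup_ubound; exists x => //=; rewrite rnormE lecR.
Qed.

Lemma op_norm_bound T M x : linear T -> (op_norm T <= M%:E)%E ->
  rnorm (T x) <= M * rnorm x.
Proof.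
move=> lT TM.
pose f : {linear X -> X} := HB.pack T (GRing.isLinear.Build _ _ _ _ T lT).
have [x0|x0] := eqVneq (rnorm x) 0.
  rewrite (rnorm_eq0 x0) rnorm0 mulr0.
  by rewrite -[T]/(f : X -> X) linear0 rnorm0.
have x_gt0 : 0 < rnorm x by rewrite lt_neqAle eq_sym x0 rnorm_ge0.
have E : rnorm (((rnorm x)^-1)%:C *: x) = 1.
  by rewrite rnormZ normcR ger0_norm ?invr_ge0 ?rnorm_ge0// mulVf.
have := @op_norm_ge T (((rnorm x)^-1)%:C *: x); rewrite E lexx => /(_ isT).
move=> /le_trans/(_ TM); rewrite lee_fin.
rewrite -[T]/(f : X -> X) linearZ/= rnormZ normcR ger0_norm ?invr_ge0 ?rnorm_ge0//.
by rewrite ler_pdivrMl// mulrC.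
Qed.

End complex_normed_modules.

(** * The operator and its resolvent *)

Section cesaro_operator.
Set Implicit Arguments.
Unset Strict Implicit.
Context {R : realType} (p : \bar R) (p1 : (1 <= p)%E).
Hypothesis p_gt1 : (1 < p)%E.
Local Notation ellp := (ell p1).
Local Notation normc := Normc.normc.
Local Notation s := (inv_exponent p).
Implicit Types (x y : ellp) (T : ellp -> ellp).

Lemma inv_exponent_ge0 : 0 <= s.
Proof.
move: p1; rewrite /inv_exponent; case: p => [r| |]//.
by rewrite lee_fin invr_ge0; exact: le_trans.
Qed.

Lemma inv_exponent_lt1 : s < 1.
Proof.
move: p_gt1; rewrite /inv_exponent; case: p => [r| |]//.
by rewrite lte_fin => r1; rewrite invf_lt1// (lt_trans ltr01).
Qed.

Lemma ell_norm_rnorm x : ell_norm p x = (rnorm x)%:E.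
Proof.
rewrite /rnorm ell_normE/= fineK// ge0_fin_numE ?ell_norm_ge0//.
exact: ell_seqP.
Qed.

Lemma rnorm_le x (B : R) : (rnorm x <= B) = (ell_norm p x <= B%:E)%E.
Proof. by rewrite ell_norm_rnorm lee_fin. Qed.

Lemma ell_predE (x : nat -> R[i]) (B : R) :
  (ell_norm p x <= B%:E)%E -> x \in ell_pred p1.
Proof. by move=> xB; rewrite inE (le_lt_trans xB)// ltry. Qed.

Lemma normc_coord_le_rnorm x n : normc (x n) <= rnorm x.
Proof.
by apply: (normc_coord_le n p1); rewrite ?rnorm_ge0 ?ell_norm_rnorm.
Qed.

Lemma ellP x y : (forall n, x n = y n) -> x = y.
Proof. by move=> xy; apply/val_inj/funext => n; exact: xy. Qed.

Lemma ell_coordD x y n : (x + y : ellp) n = x n + y n.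
Proof. by []. Qed.

Lemma ell_coordN x n : (- x : ellp) n = - x n.
Proof. by []. Qed.

Lemma ell_coordB x y n : (x - y : ellp) n = x n - y n.
Proof. by []. Qed.

Lemma ell_coordZ (a : R[i]) x n : (a *: x : ellp) n = a * x n.
Proof. by []. Qed.

Lemma ell_coord_sum (I : Type) (t : seq I) (P : pred I) (F : I -> ellp) n :
  (\sum_(i <- t | P i) F i : ellp) n = \sum_(i <- t | P i) F i n.
Proof. by elim/big_rec2: _ => // i a y _ <-. Qed.

Lemma delta_mem m : (fun n => (n == m)%:R : R[i]) \in ell_pred p1.
Proof. exact: ell_predE (ell_norm_delta_le _ _). Qed.

Definition ell_delta m : ellp := Ell (delta_mem m).

Lemma ell_deltaE m n : ell_delta m n = (n == m)%:R.
Proof. by []. Qed.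

Lemma rnorm_delta m : rnorm (ell_delta m) = 1.
Proof.
apply/eqP; rewrite eq_le rnorm_le ell_norm_delta_le//=.
by have := normc_coord_le_rnorm (ell_delta m) m; rewrite ell_deltaE normc_nat eqxx.
Qed.

Lemma cesaro_mem x : cesaro_seq x \in ell_pred p1.
Proof.
apply: ell_predE (cesaro_ell_norm_le p_gt1 inv_exponent_lt1 (rnorm_ge0 x) _).
by rewrite ell_norm_rnorm.
Qed.

Definition cesaro_op x : ellp := Ell (cesaro_mem x).

Lemma cesaro_op_linear : linear cesaro_op.
Proof. by move=> a x y; apply/val_inj; exact: cesaro_seq_linear. Qed.

Lemma rnorm_cesaro_le x : rnorm (cesaro_op x) <= (1 - s)^-1 * rnorm x.
Proof.
rewrite rnorm_le mulrC.
by apply: cesaro_ell_norm_le; rewrite ?rnorm_ge0 ?inv_exponent_lt1 ?ell_norm_rnorm.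
Qed.

Lemma cesaro_op_bounded_linear : bounded_linear cesaro_op.
Proof. exact: bounded_linear_of_bound cesaro_op_linear rnorm_cesaro_le. Qed.

Lemma op_norm_cesaro_le : (op_norm cesaro_op <= ((1 - s)^-1)%:E)%E.
Proof.
apply: op_norm_le => x x1; apply: le_trans (rnorm_cesaro_le x) _.
by rewrite ger_pMr// invr_gt0 subr_gt0 inv_exponent_lt1.
Qed.

Lemma resolvent_mem w (b : ellp) : complex.Re w < 1 - s ->
  w *: ((b : nat -> R[i]) + resolvent_seq w b) \in ell_pred p1.
Proof.
move=> w1; apply: GRing.rpredZ; apply: GRing.rpredD; first exact: ell_seqP.
apply: ell_predE (resolvent_ell_norm_le p_gt1 inv_exponent_ge0 w1 (rnorm_ge0 b) _).
by rewrite ell_norm_rnorm.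
Qed.

Lemma resolvent_cesaro (z : R[i]) : z != 0 -> complex.Re z^-1 < 1 - s ->
  resolvent_set cesaro_op z.
Proof.
move=> z0 wp; set w := z^-1 in wp.
have w0 : w != 0 by rewrite invr_eq0.
have wn n : n.+1%:R - w != 0.
  by apply: natrB_neq0; apply: lt_le_trans wp _; rewrite gerBl inv_exponent_ge0.
pose S (b : ellp) : ellp := Ell (resolvent_mem b wp).
have SE b n : S b n = w * (b n + resolvent_seq w b n) by [].
have d0 : 0 < 1 - s - complex.Re w by rewrite subr_gt0.
exists S; split.
- apply: (@bounded_linear_of_bound _ _ _
    (normc w * (1 + normc w / (1 - s - complex.Re w)))).
    move=> a x y; apply: ellP => n; rewrite ell_coordD ell_coordZ !SE.
    rewrite (_ : ((a *: x + y : ellp) : nat -> R[i]) =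
      a *: (x : nat -> R[i]) + (y : nat -> R[i]))// resolvent_seq_linear//.
    change (w * ((a * x n + y n) + (a * resolvent_seq w x n + resolvent_seq w y n))
      = a * (w * (x n + resolvent_seq w x n)) + w * (y n + resolvent_seq w y n)).
    by ring.
  move=> b; rewrite rnorm_le ell_normZ// -mulrA EFinM.
  apply: lee_wpmul2l; first by rewrite lee_fin normc_ge0.
  apply: le_trans (ler_ell_normD _ _ p1) _.
  rewrite ell_norm_rnorm mulrDl mul1r EFinD leeD2l// mulrAC.
  apply: (resolvent_ell_norm_le p_gt1) => //; rewrite ?inv_exponent_ge0 ?rnorm_ge0//.
  by rewrite ell_norm_rnorm.
- move=> x; apply: ellP => n; rewrite SE.
  have zE : z = w^-1 by rewrite invrK.
  rewrite (_ : ((z *: x - cesaro_op x : ellp) : nat -> R[i]) =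
      w^-1 *: (x : nat -> R[i]) - cesaro_seq x) ?zE//.
  rewrite resolvent_cesaro_seq//.
  by change (w * (w^-1 * x n - cesaro_seq x n + cesaro_seq x n) = x n);
    rewrite subrK mulrA divff// mul1r.
- move=> x; apply: ellP => n; rewrite ell_coordB ell_coordZ SE.
  rewrite (_ : cesaro_op (S x) n =
    cesaro_seq (w *: ((x : nat -> R[i]) + resolvent_seq w x)) n)//.
  by rewrite cesaro_resolvent_seq// mulrA divff// mul1r addrK.
Qed.

Lemma spectrum_cesaro_sub :
  spectrum cesaro_op `<=`
    [set z | `|z - ((1 - s)^-1 / 2)%:C| <= ((1 - s)^-1 / 2)%:C].
Proof.
have r0 : 0 < (1 - s)^-1 by rewrite invr_gt0 subr_gt0 inv_exponent_lt1.
(* The point 0 lies on the boundary circle but has no inverse, so it is checked directly. *)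
move=> z /= nz; have [->|z0] := eqVneq z 0.
  by rewrite sub0r normrN Defs.normcE lecR normcR ger0_norm// divr_ge0// ltW.
rewrite disc_ReV// invrK leNgt; apply/negP => H.
exact: nz (resolvent_cesaro z0 H).
Qed.

End cesaro_operator.

(** * Sequences outside l^p inside the disc *)

Section spectrum.
Set Implicit Arguments.
Unset Strict Implicit.
Context {R : realType}.
Local Notation normc := Normc.normc.

(** The modulus exceeds the real part by O(1/n) only. This supplies the coefficient n+1-al+c/(n+1)
    of [growth_lower_bound] and [resonance_unbounded], with c = |w|^2. *)
Lemma normc_natB_le (w : R[i]) n : 0 < complex.Re w ->
  2 * complex.Re w <= n.+1%:R ->
  normc (n.+1%:R - w) <= n.+1%:R - complex.Re w + normc w ^+ 2 / n.+1%:R.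
Proof.
case: w => a c /= a0 an; rewrite -(rmorph_nat (@real_complex R))/= sub0r.
rewrite sqr_sqrtr ?addr_ge0 ?sqr_ge0// sqrrN.
have m0 : 0 < n.+1%:R :> R by [].
move: m0 an; move: n.+1%:R => m m0 an.
have am : 0 <= m - a by move: an a0; lra.
have q0 : 0 <= (a ^+ 2 + c ^+ 2) / m.
  by rewrite divr_ge0 ?addr_ge0 ?sqr_ge0// ltW.
rewrite -(ger0_norm (addr_ge0 am q0)) -sqrtr_sqr ler_sqrt ?sqr_ge0//.
have aq : 2 * a * ((a ^+ 2 + c ^+ 2) / m) <= a ^+ 2 + c ^+ 2.
  rewrite mulrA ler_pdivrMr// [leRHS]mulrC ler_wpM2r ?addr_ge0 ?sqr_ge0//.
have mq : m * ((a ^+ 2 + c ^+ 2) / m) = a ^+ 2 + c ^+ 2.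
  by rewrite mulrC divfK// gt_eqF.
move: aq mq q0; move: (_ / m) => q aq mq q0.
have := sqr_ge0 q; have := sqr_ge0 a; nra.
Qed.

(** With forcing e_0 the recursion is homogeneous from index 1 on, so |A_n| is eventually at least K
    (n+1)^(-1/r); the r-th powers dominate the harmonic series. *)
Lemma recursion_growth_unbounded (w : R[i]) (r B : R) :
  1 < r -> 1 - r^-1 <= complex.Re w -> (forall n, n.+1%:R - w != 0) ->
  ~ (ell_norm r%:E (resolvent_seq w (fun n => (n == 0%N)%:R)) <= B%:E)%E.
Proof.
move=> r1 wr wn uB.
have r0 : 0 < r by exact: lt_trans r1.
have s1 : r^-1 < 1 by rewrite invf_lt1.
have w0 : 0 < complex.Re w by apply: lt_le_trans wr; rewrite subr_gt0.
pose A := resolvent_seq w (fun n => (n == 0%N)%:R).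
have AS n : (n.+1%:R - w) * A n = n%:R * A n.-1 + w * (n == 0%N)%:R.
  exact: resolvent_seqS.
have A0 n : A n != 0.
  elim: n => [|n IH].
    apply/eqP => A00; have := AS 0%N; rewrite A00 mulr0 mul0r add0r mulr1.
    by move=> wE; move: w0; rewrite -wE ltxx.
  apply/eqP => An; have := AS n.+1; rewrite An !mulr0 addr0 => /esym/eqP.
  by rewrite mulf_eq0 pnatr_eq0/= (negbTE IH).
have u0 n : 0 < normc (A n).
  rewrite lt_neqAle normc_ge0 andbT eq_sym; apply/eqP => /Normc.eq0_normc An.
  by move: (A0 n); rewrite An eqxx.
have [] := @growth_lower_bound R (complex.Re w) (1 - r^-1) (normc w ^+ 2)
    (Num.trunc (2 * complex.Re w)).+1 (fun n => normc (A n)).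
- by rewrite subr_gt0 s1 gerBl invr_ge0 ltW.
- exact: wr.
- exact: sqr_ge0.
- exact: u0.
- move=> [//|n] Hn; rewrite -normc_nat -Normc.normcM /=.
  have := AS n.+1; rewrite /= mulr0 addr0 => <-.
  rewrite Normc.normcM ler_wpM2r ?normc_ge0// normc_natB_le//.
  apply/ltW/(lt_le_trans (truncnS_gt _)); rewrite ler_nat.
  by rewrite (leq_trans Hn).
move=> K [N [K0 HK]].
have B0 : 0 <= B by rewrite -lee_fin; apply: le_trans uB; exact: ell_norm_ge0.
have H := proj1 (ell_norm_le_fin _ r0 B0) uB.
have [M HM] := harmonic_unbounded
  (B `^ r / K `^ r + \sum_(n < N) n.+1%:R^-1 : R).
have Kr0 : 0 < K `^ r by rewrite powR_gt0.
have lower n : (N <= n)%N -> K `^ r / n.+1%:R <= normc (A n) `^ r.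
  move=> Nn; have -> : K `^ r / n.+1%:R = (K * n.+1%:R `^ (1 - r^-1 - 1)) `^ r.
    rewrite powRM ?(ltW K0) ?powR_ge0// -powRrM; congr (_ * _).
    have -> : (1 - r^-1 - 1) * r = -1.
      by rewrite addrAC subrr sub0r mulNr mulVf// gt_eqF.
    by rewrite powR_inv1.
  rewrite ge0_ler_powR ?nnegrE ?mulr_ge0 ?normc_ge0 ?powR_ge0 ?(ltW r0) ?(ltW K0)//.
  exact: HK.
have sums k : K `^ r * (\sum_(n < k) n.+1%:R^-1 - \sum_(n < N) n.+1%:R^-1)
    <= \sum_(n < k) normc (A n) `^ r.
  elim: k => [|k IH].
    by rewrite !big_ord0 sub0r mulrN oppr_le0 mulr_ge0 ?(ltW Kr0)// sumr_ge0.
  rewrite big_ord_recr/= addrAC mulrDr [leRHS]big_ord_recr/=.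
  have [Nk|kN] := leqP N k; first by rewrite lerD// lower.
  (* For k < N the left-hand side is nonpositive. *)
  rewrite -mulrDr; apply: (@le_trans _ _ 0); last first.
    by rewrite addr_ge0 ?powR_ge0// sumr_ge0// => i _; rewrite powR_ge0.
  rewrite pmulr_rle0// addrAC subr_le0 -(big_ord_recr k (fun n => n.+1%:R^-1))/=.
  rewrite (big_ord_widen N (fun k => k.+1%:R^-1) kN).
  by rewrite [leRHS](bigID (fun i : 'I_N => (i < k.+1)%N))/= lerDl sumr_ge0.
have := le_trans (sums M) (H M).
rewrite leNgt => /negP; apply.
by rewrite -ltr_pdivrMl// mulrC ltrBrDr.
Qed.

(** The value 1 at 0 keeps the modulus equal to 1 for every v. *)
Definition phase (v : R[i]) : R[i] := if v == 0 then 1 else v / (normc v)%:C.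

Lemma phaseE v : (normc v)%:C * phase v = v.
Proof.
rewrite /phase; case: eqVneq => [->|v0]; first by rewrite Normc.normc0 mul0r.
rewrite mulrC divfK// (inj_eq (@complexI R) _ 0).
by apply/eqP => /Normc.eq0_normc/eqP; rewrite (negbTE v0).
Qed.

Lemma normc_phase v : normc (phase v) = 1.
Proof.
rewrite /phase; case: eqVneq => [_|v0]; first exact: Normc.normc1.
have n0 : normc v != 0.
  by apply/eqP => /Normc.eq0_normc/eqP; rewrite (negbTE v0).
by rewrite Normc.normcM Normc.normcV normcR ger0_norm ?normc_ge0// divff.
Qed.

(* The forcing term is aligned in phase with [A_(n-1)], so that the moduli add
   up: [|n+1-w| |A_n| = n |A_(n-1)| + |w|]. *)
Fixpoint resonant_seq (w : R[i]) n : R[i] :=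
  if n is m.+1 then
    (n%:R * resonant_seq w m + (normc w)%:C * phase (resonant_seq w m)) /
    (n.+1%:R - w)
  else (normc w)%:C / (1 - w).

(** The unimodular factor |w|/w turns the term w b_n of [resolvent_seq] into |w| times a phase, so
    [resonant_seq] is the response to this forcing. *)
Definition resonant_forcing (w : R[i]) n : R[i] :=
  w^-1 * (normc w)%:C * (if n is m.+1 then phase (resonant_seq w m) else 1).

Lemma resonant_forcing_le w n : w != 0 -> normc (resonant_forcing w n) <= 1.
Proof.
move=> w0; have n0 : normc w != 0.
  by apply/eqP => /Normc.eq0_normc/eqP; rewrite (negbTE w0).
rewrite /resonant_forcing !Normc.normcM Normc.normcV normcR.
rewrite ger0_norm ?normc_ge0// mulVf// mul1r.
by case: n => [|n]; rewrite ?normc_phase ?Normc.normc1.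
Qed.

Lemma resonant_unbounded (w : R[i]) (B : R) :
  1 <= complex.Re w -> (forall n, n.+1%:R - w != 0) ->
  ~ (forall n, normc (resolvent_seq w (resonant_forcing w) n) <= B).
Proof.
move=> w1 wn uB.
have wp : 0 < complex.Re w by exact: lt_le_trans w1.
have w0 : w != 0 by apply: contraTneq wp => ->; rewrite ltxx.
have n0 : 0 < normc w by apply: lt_le_trans wp (Re_le_normc w).
have E : resolvent_seq w (resonant_forcing w) = resonant_seq w.
  apply: (recursion_inj (d := fun n => n.+1%:R - w)) => // [n|[|n]].
  - exact: resolvent_seqS.
  - rewrite mul0r add0r /= /resonant_forcing mulr1 mulVKf// mulrC divfK//.
    exact: (wn 0).
  - rewrite /= mulrC divfK// /resonant_forcing !mulrA mulfV// mul1r.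
    by [].
rewrite E in uB.
apply: (@resonance_unbounded R (complex.Re w) (normc w ^+ 2) (normc w) B
  (Num.trunc (2 * complex.Re w)).+1 (fun n => normc (resonant_seq w n))) => //.
- exact: sqr_ge0.
- by move=> n; rewrite normc_ge0 uB.
move=> [//|n] Hn.
apply: (@le_trans _ _ (normc (n.+2%:R - w) * normc (resonant_seq w n.+1))).
  rewrite -Normc.normcM /= [X in _ <= normc X]mulrC divfK//.
  set v := resonant_seq w n.
  (* Both summands are nonnegative multiples of the same phase, so the triangle inequality is an
     equality. *)
  have -> : n.+1%:R * v + (normc w)%:C * phase v =
      (n.+1%:R * normc v + normc w)%:C * phase v.
    by rewrite -{1}[v]phaseE rmorphD rmorphM/= rmorph_nat; ring.
  rewrite Normc.normcM normc_phase mulr1 normcR.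
  by rewrite ger0_norm ?addr_ge0 ?mulr_ge0 ?normc_ge0.
rewrite ler_wpM2r ?normc_ge0// normc_natB_le//.
apply/ltW/(lt_le_trans (truncnS_gt _)); rewrite ler_nat.
by rewrite (leq_trans Hn).
Qed.

End spectrum.

(** * The full spectrum, a criterion against compactness, and supercyclicity *)

Section cesaro_operator_properties.
Set Implicit Arguments.
Unset Strict Implicit.
Context {R : realType} (p : \bar R) (p1 : (1 <= p)%E) (p_gt1 : (1 < p)%E).
Local Notation ellp := (ell p1).
Local Notation normc := Normc.normc.
Local Notation s := (inv_exponent p).
Local Notation C := (@cesaro_op R p p1 p_gt1).
Local Notation delta := (ell_delta p1).
Implicit Types (x y : ellp).

Lemma ltr0c_real (e : R) : 0 < e -> 0 < e%:C.
Proof. by move=> e0; rewrite -[0]/(0%:C) ltcR. Qed.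

Lemma zero_spectrum : spectrum C 0.
Proof.
move=> [S [bS _ SR]]; have [K SK] := bounded_linear_bound bS.
have K0 : 0 <= K.
  by have := SK (delta 0%N); rewrite rnorm_delta mulr1; apply/le_trans/rnorm_ge0.
pose m := Num.trunc K.
(* At z = 0 the inverse S satisfies C_1 S e_m = -e_m; the recursion at index m then gives (S e_m)_m
   = -(m+1), beyond the bound K. *)
have CS n : cesaro_seq (S (delta m)) n = - (delta m n : R[i]).
  have : (0 *: S (delta m) - C (S (delta m))) n = delta m n by rewrite SR.
  by rewrite scale0r sub0r ell_coordN => <-; rewrite opprK.
have Sm : S (delta m) m = - m.+1%:R.
  have := cesaro_seqS (S (delta m)) m.
  rewrite !CS /= eqxx mulrN mulr1 => ->.
  case: (m) => [|k]; first by rewrite mul0r add0r.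
  by rewrite /= (ltn_eqF (ltnSn k)) oppr0 mulr0 add0r.
have := normc_coord_le_rnorm (S (delta m)) m.
rewrite Sm normcN normc_nat leNgt => /negP; apply.
apply: le_lt_trans (truncnS_gt K).
apply: le_trans (SK _) _.
by rewrite rnorm_delta mulr1.
Qed.

(** The solution A = C_1 (S b) lies in l^p, so z is in the spectrum as soon as some b admits no l^p
    solution of the recursion. *)
Lemma resolvent_solution (z : R[i]) (b : ellp) : z != 0 ->
  resolvent_set C z ->
  exists A : ellp, forall n,
    (n.+1%:R - z^-1) * A n = n%:R * A n.-1 + z^-1 * b n.
Proof.
move=> z0 [S [_ _ SR]]; exists (C (S b)) => n.
rewrite mulrBl [_ * C _ n]cesaro_seqS -addrA; congr (_ + _).
have : (z *: S b - C (S b)) n = b n by rewrite SR.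
rewrite ell_coordB ell_coordZ => <-.
by rewrite mulrBr mulKf.
Qed.

(** With w = m+1 the recursion forces A_n = 0 for n < m; at index m the left coefficient vanishes
    and leaves 0 = w. *)
Lemma inv_nat_spectrum (z : R[i]) m : z != 0 -> m.+1%:R = z^-1 -> spectrum C z.
Proof.
move=> z0 wm /(resolvent_solution (delta m) z0)[A AS].
have wn n : (n < m)%N -> n.+1%:R - z^-1 != 0.
  by move=> nm; rewrite -wm subr_eq0 eqr_nat eqSS ltn_eqF.
have An n : (n < m)%N -> A n = 0.
  elim: n => [|n IH] nm; apply: (mulfI (wn _ nm));
    rewrite AS ell_deltaE ltn_eqF// !mulr0 addr0.
    by rewrite mul0r.
  by rewrite /= IH ?mulr0// ltnW.
have := AS m; rewrite -wm subrr mul0r /= eqxx mulr1 => /esym/eqP.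
case: m wm An {AS wn} => [|m] wm An.
  by rewrite mul0r add0r oner_eq0.
by rewrite /= An// mulr0 add0r pnatr_eq0.
Qed.

Lemma spectrum_cesaro : spectrum C =
    [set z | `|z - ((1 - s)^-1 / 2)%:C| <= ((1 - s)^-1 / 2)%:C].
Proof.
have s1 := inv_exponent_lt1 p_gt1.
have r0 : 0 < (1 - s)^-1 by rewrite invr_gt0 subr_gt0.
apply/seteqP; split; first exact: spectrum_cesaro_sub.
move=> z /=; have [->|z0] := eqVneq z 0; first by move=> _; exact: zero_spectrum.
rewrite disc_ReV// invrK => wz.
have [[m]|/forallNP wn] := pselect (exists m, m.+1%:R = z^-1).
  exact: inv_nat_spectrum.
have {}wn n : n.+1%:R - z^-1 != 0 by rewrite subr_eq0; exact/eqP.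
have sol (b : ellp) : resolvent_set C z ->
    (ell_norm p (resolvent_seq (z^-1)%R b) < +oo)%E.
  move=> /(resolvent_solution b z0)[A AS].
  have <- : (A : nat -> R[i]) = resolvent_seq z^-1 b.
    apply: (recursion_inj (d := fun n => n.+1%:R - z^-1)
      (e := fun n => z^-1 * b n)) => // n.
    exact: resolvent_seqS.
  exact: ell_seqP.
move=> zR.
have bnd (b : ellp) :
    (ell_norm p (resolvent_seq (z^-1)%R b) <=
       (fine (ell_norm p (resolvent_seq (z^-1)%R b)))%:E)%E.
  by rewrite fineK// ge0_fin_numE ?ell_norm_ge0// sol.
have z'0 : z^-1 != 0 by rewrite invr_eq0.
(* For p = +oo the forcing e_0 would not do: on the boundary Re w = 1 its response stays bounded.
   Hence the resonant forcing. *)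
case: p p1 p_gt1 wz bnd => [r| |]//= q1 q_gt1 wz bnd.
  apply: (recursion_growth_unbounded _ wz wn (bnd (ell_delta q1 0))).
  by move: q_gt1; rewrite lte_fin.
have fm : resonant_forcing z^-1 \in ell_pred q1.
  apply: (@ell_predE _ _ _ _ 1); apply/ell_norm_le_infty => n.
  exact: resonant_forcing_le.
rewrite subr0 in wz.
apply: (resonant_unbounded wz wn); apply/ell_norm_le_infty.
exact: (bnd (Ell fm)).
Qed.

(** A cluster point of the images T u_N would have all coordinates 0, yet the images stay at
    distance at least c from 0. *)
Lemma not_compact_of_vanishing (T : ellp -> ellp) (u : nat -> ellp) (c : R) :
  0 < c -> (forall N, rnorm (u N) <= 1) -> (forall N, c <= rnorm (T (u N))) ->
  (forall n (e : R), 0 < e -> \forall N \near \oo, normc (T (u N) n) <= e) ->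
  ~ compact_operator T.
Proof.
move=> c0 u1 uc uT cT.
pose v N := T (u N).
have vF : (v @ \oo) (closure (T @` [set x | `|x| <= 1])).
  apply: (@nearW _ \oo) => N; apply: subset_closure; exists (u N) => //=.
  by rewrite rnormE lecR.
have [y [_ yv]] := cT _ _ vF.
have y0 n : y n = 0.
  apply: Normc.eq0_normc; apply/eqP; rewrite eq_le normc_ge0 andbT.
  apply/ler_addgt0Pr => e e0; rewrite add0r.
  have e2 : 0 < e / 2 by rewrite divr_gt0.
  have [x /= [xn xy]] := yv [set x : ellp | normc (x n) <= e / 2]
    (ball y (e / 2)%:C) (uT n _ e2) (nbhsx_ballx _ _ (ltr0c_real e2)).
  rewrite (_ : y n = (y - x) n + x n); last by rewrite ell_coordB subrK.
  apply: le_trans (ler_normcD _ _) _; rewrite [leRHS]splitr lerD//.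
  apply: le_trans (normc_coord_le_rnorm _ _) _.
  move: xy; rewrite -ball_normE /= rnormE ltcR; exact: ltW.
have vc : (v @ \oo) [set x : ellp | c <= rnorm x] by apply: (@nearW _ \oo).
have [x /= [xc xy]] := yv _ (ball y c%:C) vc
  (nbhsx_ballx _ _ (ltr0c_real c0)).
move: xy; rewrite -ball_normE /= rnormE ltcR.
have -> : y = 0 by exact: ellP.
by rewrite sub0r rnormN ltNge xc.
Qed.

Lemma iter_cesaro0 x n : iter n C x 0%N = x 0%N.
Proof.
elim: n => [//|n IH]; rewrite iterS -{}IH.
by rewrite /cesaro_op/= /cesaro_seq big_ord1 divr1.
Qed.

Lemma iter_cesaro01 x n : iter n C x 0%N - iter n C x 1%N =
  2^-1 ^+ n * (x 0%N - x 1%N).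
Proof.
elim: n => [|n IH]; first by rewrite expr0 mul1r.
rewrite exprS -mulrA -IH iterS.
move: (iter n C x) => y.
rewrite /cesaro_op/= /cesaro_seq !big_ord_recr !big_ord0/=.
by field.
Qed.

Lemma dense_approx (S : set ellp) : dense S -> forall y (e : R), 0 < e ->
  exists2 x, S x & rnorm (y - x) < e.
Proof.
move=> dS y e e0.
have [] := dS (interior (ball y e%:C)).
- by exists y; apply: nbhsx_ballx; exact: ltr0c_real.
- exact: open_interior.
move=> x [/interior_subset xy Sx]; exists x => //.
by move: xy; rewrite -ball_normE/= rnormE ltcR.
Qed.

(* The functionals [x_0] and [x_0 - x_1] are eigenvectors of the adjoint with
   eigenvalues 1 and 1/2, so their ratio stays bounded along every orbit. *)
Lemma not_supercyclic_cesaro : ~ supercyclic C.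
Proof.
move=> [x /dense_approx dx].
(* If x_0 = 0 the whole orbit lies in a hyperplane at distance at least 1 from e_0. *)
have [x0|x0] := eqVneq (x 0%N : R[i]) 0.
  have [_ [z [n ->]]] := dx (delta 0%N) 1 ltr01.
  move=> /(le_lt_trans (normc_coord_le_rnorm _ 0%N)).
  rewrite ell_coordB ell_coordZ iter_cesaro0 x0 mulr0 subr0.
  by rewrite ell_deltaE normc_nat eqxx ltxx.
pose a := normc (x 0%N); pose b := normc (x 0%N - x 1%N).
have a0 : 0 < a.
  rewrite lt_neqAle normc_ge0 andbT eq_sym; apply/eqP => /Normc.eq0_normc xa.
  by move: x0; rewrite xa eqxx.
pose K := b / a.
have K0 : 0 <= K by rewrite divr_ge0 ?normc_ge0.
(* On the orbit |y_0 - y_1| <= K |y_0|. Approximating e_1 within e would give 1 <= |y_1 - y_0| +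
   |y_0| + |1 - y_1| <= (K + 2) e < 1. *)
pose e := (K + 3)^-1.
have K3 : 0 < K + 3 by rewrite ltr_wpDl.
have e0 : 0 < e by rewrite invr_gt0.
have [_ [z [n ->]]] := dx (delta 1%N) e e0.
set y := z *: _ => ye.
have y0 : y 0%N = z * x 0%N by rewrite ell_coordZ iter_cesaro0.
have y01 : y 0%N - y 1%N = z * (2^-1 ^+ n * (x 0%N - x 1%N)).
  by rewrite !ell_coordZ -mulrBr iter_cesaro01.
have yK : normc (y 0%N - y 1%N) <= K * normc (y 0%N).
  rewrite y01 y0 !Normc.normcM -/a -/b /K.
  rewrite [leRHS]mulrCA divfK ?gt_eqF//.
  have n2 : normc (2^-1 ^+ n : R[i]) <= 1.
    have -> : (2^-1 ^+ n : R[i]) = (2^-1 ^+ n)%:C.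
      by rewrite rmorphXn/= fmorphV rmorph_nat.
    rewrite normcR ger0_norm ?exprn_ge0 ?invr_ge0//.
    by rewrite exprn_ile1 ?invr_ge0// invf_le1// ler1n.
  by rewrite ler_wpM2l ?normc_ge0// -[leRHS]mul1r ler_wpM2r ?normc_ge0.
have h0 : normc (y 0%N) < e.
  apply: le_lt_trans ye; apply: le_trans (normc_coord_le_rnorm _ 0%N).
  by rewrite ell_coordB /= sub0r normcN.
have h1 : normc (1 - y 1%N) < e.
  apply: le_lt_trans ye; have := normc_coord_le_rnorm (delta 1%N - y) 1%N.
  by rewrite ell_coordB ell_deltaE eqxx.
have t1 := ler_normcD (y 1%N - y 0%N) (y 0%N + (1 - y 1%N)).
have t2 := ler_normcD (y 0%N) (1 - y 1%N).
rewrite addrA subrK subrKC Normc.normc1 -opprB normcN in t1.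
have : e * (K + 3) = 1 by rewrite /e mulVf// gt_eqF.
have := ler_wpM2l K0 (ltW h0); lra.
Qed.

End cesaro_operator_properties.

(** * Growth of the iterates for finite p *)

Section real_iterates.
Set Implicit Arguments.
Unset Strict Implicit.
Context {R : realType}.
Implicit Types (z : nat -> R).

Lemma iter_cesaro_real_ge0 z j : (forall n, 0 <= z n) ->
  forall n, 0 <= iter j cesaro_real z n.
Proof.
by move=> z0; elim: j => [//|j IH] n; rewrite iterS; exact: cesaro_real_ge0.
Qed.

Lemma iter_dual_weight_bound (a B : R) z j : 0 < a <= 1 ->
  (forall n, 0 <= z n) ->
  (forall N, \sum_(n < N) n.+1%:R `^ (- a) * iter j cesaro_real z n <= B) ->
  forall M, \sum_(n < M) n.+1%:R `^ (- a) * z n <= a ^+ j * B.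
Proof.
move=> a01; elim: j z => [|j IH] z z0 H; first by rewrite expr0 mul1r.
rewrite exprS -mulrA; apply: dual_weight_bound => //.
apply: IH; first exact: cesaro_real_ge0.
by move=> N; rewrite -iterSr.
Qed.

Lemma cesaro_seq_real z :
  cesaro_seq (fun n => (z n)%:C) = (fun n => (cesaro_real z n)%:C).
Proof.
apply/funext => n; rewrite /cesaro_seq /cesaro_real.
by rewrite rmorphM/= fmorphV rmorph_nat rmorph_sum.
Qed.

(** Cesaro's theorem on averages of convergent sequences, iterated; it makes the ergodic means of
    e_0 vanish at infinity. *)
Lemma cvg_iter_cesaro_real z j : z @ \oo --> (0 : R) ->
  iter j cesaro_real z @ \oo --> (0 : R).
Proof.
move=> z0; elim: j => [//|j IH]; rewrite iterS.
have -> : cesaro_real (iter j cesaro_real z) =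
    arithmetic_mean (iter j cesaro_real z).
  apply/funext => n; rewrite /cesaro_real /arithmetic_mean/= seriesEnat/=.
  by rewrite big_mkord mulrC.
exact: cesaro.
Qed.

Lemma exists_pos_mul1D_lt1 (c : R) : 0 < c < 1 ->
  exists e, 0 < e <= 1 /\ (1 + e) * c < 1.
Proof.
move=> /andP[c0 c1]; exists ((1 - c) / 2); split; last by nra.
by apply/andP; split; lra.
Qed.

Lemma geometric_small (x e : R) : 0 <= x < 1 -> 0 < e ->
  \forall n \near \oo, x ^+ n < e.
Proof.
move=> /andP[x0 x1] e0; have := @cvg_expr R x.
rewrite ger0_norm// => /(_ x1)/cvgrPdist_lt/(_ e e0).
by apply: filterS => n; rewrite sub0r normrN ger0_norm// exprn_ge0.
Qed.

(** Bernoulli's inequality; it lets a slightly larger geometric ratio absorb a linear factor. *)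
Lemma natr_le_exp1D (e : R) n : 0 < e -> n%:R <= (1 + e) ^+ n / e.
Proof.
move=> e0; rewrite ler_pdivlMr//.
suff : n%:R * e + 1 <= (1 + e) ^+ n by move/(le_trans _); apply; rewrite lerDl.
elim: n => [|n IH]; first by rewrite mul0r add0r expr0.
rewrite exprS -natr1.
have : 0 <= n%:R * e ^+ 2 by rewrite mulr_ge0// sqr_ge0.
have := ler_wpM2l (ltW e0) IH; move: IH; lra.
Qed.

End real_iterates.

Section cesaro_iterates.
Set Implicit Arguments.
Unset Strict Implicit.
Context {R : realType} (p : \bar R) (p1 : (1 <= p)%E) (p_gt1 : (1 < p)%E).
Local Notation ellp := (ell p1).
Local Notation normc := Normc.normc.
Local Notation s := (inv_exponent p).
Local Notation C := (@cesaro_op R p p1 p_gt1).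
Local Notation delta := (ell_delta p1).

Definition delta_real (n : nat) : R := (n == 0%N)%:R.

Lemma iter_cesaro_delta j :
  (iter j C (delta 0%N) : nat -> R[i]) =
  (fun n => (iter j cesaro_real delta_real n)%:C).
Proof.
elim: j => [|j IH].
  by apply/funext => n; rewrite /= rmorph_nat.
by rewrite !iterS -cesaro_seq_real -IH.
Qed.

End cesaro_iterates.

Section cesaro_growth.
Set Implicit Arguments.
Unset Strict Implicit.
Context {R : realType} (r : R) (p1 : (1 <= r%:E)%E) (p_gt1 : (1 < r%:E)%E).
Local Notation normc := Normc.normc.
Local Notation s := (inv_exponent r%:E).
Local Notation C := (@cesaro_op R r%:E p1 p_gt1).
Local Notation delta := (ell_delta p1).

(** Put a = (1+e)/p'. The p'-th power of the weight (n+1)^(-a) is (n+1)^(-(1+e)), which is summable,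
    so the pairing with C_1^j e_0 is at most K times its norm. By [iter_dual_weight_bound] the
    pairing with e_0, which is 1, is at most a^j times that. *)
Lemma iter_cesaro_growth (e : R) : 0 < e <= 1 ->
  (1 + e) * (1 - s) <= 1 ->
  exists2 K, 0 < K &
    forall j, 1 <= ((1 + e) * (1 - s)) ^+ j * (K * rnorm (iter j C (delta 0%N))).
Proof.
move=> e01 a1; have /andP[e0 e1] := e01.
have r1 : 1 < r by move: p_gt1; rewrite lte_fin.
have r0 : 0 < r by exact: lt_trans r1.
have s1 : 0 < 1 - s by rewrite subr_gt0 inv_exponent_lt1.
pose a := (1 + e) * (1 - s); rewrite -/a in a1 *.
have a0 : 0 < a by rewrite mulr_gt0// ltr_wpDl// ler01.
pose K := s + (1 + e^-1) * (1 - s).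
have K0 : 0 < K.
  by rewrite ltr_wpDl ?inv_exponent_ge0// mulr_gt0// ltr_wpDr// invr_ge0 ltW.
exists K => // j; set t := rnorm _; pose g := iter j cesaro_real (@delta_real R).
have g0 n : 0 <= g n by apply: iter_cesaro_real_ge0 => k; rewrite ler0n.
have ng n : normc (iter j C (delta 0%N) n) = g n.
  by rewrite iter_cesaro_delta normcR ger0_norm.
have t0 : 0 < t.
  apply: lt_le_trans (normc_coord_le_rnorm _ 0%N).
  by rewrite iter_cesaro0 ell_deltaE eqxx Normc.normc1.
(* Normalising by t lets the termwise Young inequality sum up to a Hölder bound with constant K. *)
have gt N : \sum_(n < N) (g n / t) `^ r <= 1.
  have : (ell_norm r%:E (iter j C (delta 0%N)) <= t%:E)%E by rewrite ell_norm_rnorm.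
  move/(ell_norm_le_fin _ r0 (ltW t0))/(_ N).
  under eq_bigr => n _ do rewrite ng.
  move=> H; under eq_bigr => n _ do rewrite powRM ?invr_ge0 ?(ltW t0)//.
  have -> : t^-1 `^ r = (t `^ r)^-1.
    by rewrite -powR_inv1 ?(ltW t0)// -powRrM mulN1r powRN.
  by rewrite -mulr_suml ler_pdivrMr ?powR_gt0// mul1r.
have bound N : \sum_(n < N) n.+1%:R `^ (- a) * g n <= K * t.
  have -> : \sum_(n < N) n.+1%:R `^ (- a) * g n =
      t * \sum_(n < N) g n / t * n.+1%:R `^ (- a).
    rewrite mulr_sumr; apply: eq_bigr => n _.
    by rewrite mulrA [t * _]mulrC divfK ?gt_eqF// mulrC.
  rewrite [leRHS]mulrC ler_pM2l//.
  apply: (@le_trans _ _ (\sum_(n < N)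
      ((g n / t) `^ r * s + n.+1%:R `^ (- (1 + e)) * (1 - s)))).
    apply: ler_sum => n _.
    have := @conjugate_powR R (g n / t) (n.+1%:R `^ (- a)) r (1 - s)^-1.
    rewrite invrK divr_ge0 ?(ltW t0)// powR_ge0 invr_gt0 s1.
    move=> /(_ isT isT r0 isT); rewrite subrKC => /(_ erefl).
    rewrite -powRrM (_ : - a * (1 - s)^-1 = - (1 + e))//.
    by rewrite mulNr mulfK// gt_eqF.
  rewrite big_split/= -!mulr_suml lerD//.
    by rewrite ler_piMl ?gt ?invr_ge0 ?(ltW r0).
  by rewrite ler_wpM2r ?(ltW s1)// sum_powRN_le.
have := @iter_dual_weight_bound R a (K * t) (@delta_real R) j _ _ bound 1.
by rewrite a0 a1 big_ord1 powR1 mul1r; apply => // n; rewrite ler0n.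
Qed.

(** A norm M < p' would give |C_1^j e_0| <= M^j, against growth at rate 1/a with a slightly larger
    than 1/p'. *)
Lemma op_norm_cesaro_ge : (((1 - s)^-1)%:E <= op_norm C)%E.
Proof.
have s1 : 0 < 1 - s by rewrite subr_gt0 inv_exponent_lt1.
have s0 : 0 <= s by rewrite inv_exponent_ge0.
have r1 : 1 < r by move: p_gt1; rewrite lte_fin.
have sp : 0 < s by rewrite invr_gt0 (lt_trans ltr01).
rewrite leNgt; apply/negP => H.
have N0 : (0 <= op_norm C)%E.
  apply: le_trans (@op_norm_ge _ _ C 0 _); last by rewrite rnorm0.
  by rewrite lee_fin rnorm_ge0.
have NM : op_norm C = (fine (op_norm C))%:E.
  by rewrite fineK// ge0_fin_numE// (lt_trans H)// ltry.
pose M := fine (op_norm C); rewrite -/M in NM.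
have M0 : 0 <= M by rewrite -lee_fin -NM.
have MC j : rnorm (iter j C (delta 0%N)) <= M ^+ j.
  elim: j => [|j IH]; first by rewrite expr0 rnorm_delta.
  rewrite iterS exprS.
  apply: (le_trans (@op_norm_bound _ _ C M _ (@cesaro_op_linear _ _ _ _) _)).
    by rewrite NM.
  by rewrite ler_wpM2l.
have Ms : M * (1 - s) < 1.
  by rewrite -ltr_pdivlMr// div1r -lte_fin -NM.
(* The maximum makes one e serve twice: (1+e)(1-s) <= 1 for the growth estimate and (1+e)(1-s) M < 1
   for the contradiction. *)
pose c := Num.max 1 M * (1 - s).
have c01 : 0 < c < 1.
  rewrite mulr_gt0 ?lt_max ?ltr01// /c /Num.max; case: ifP => _ //.
  by rewrite mul1r gtrBl.
have [e [e01 ec]] := exists_pos_mul1D_lt1 c01.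
have e0 : 0 < 1 + e by case/andP: e01 => e0 _; rewrite ltr_wpDl// ler01.
have cm x : x <= Num.max 1 M -> (1 + e) * (1 - s) * x < 1.
  move=> xm; apply: le_lt_trans ec; rewrite -mulrA ler_pM2l// /c mulrC.
  by rewrite ler_wpM2r// ltW.
have [|K K0 HK] := @iter_cesaro_growth e e01.
  by have := cm 1; rewrite mulr1 le_max lexx => /(_ isT)/ltW.
have K'0 : 0 < K^-1 by rewrite invr_gt0.
have x0 : 0 <= (1 + e) * (1 - s) * M by rewrite !mulr_ge0// ltW.
have xM : (1 + e) * (1 - s) * M < 1 by apply: cm; rewrite le_max lexx orbT.
have [N _ HN] := @geometric_small R ((1 + e) * (1 - s) * M) K^-1
  (introT andP (conj x0 xM)) K'0.
have := HN N (leqnn _); rewrite /= exprMn -(ltr_pM2l K0) divff ?gt_eqF//.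
apply/negP; rewrite -leNgt; apply: le_trans (HK N) _.
by rewrite mulrCA ler_pM2l// ler_wpM2l// exprn_ge0// mulr_ge0// ltW.
Qed.

(** As 1/p' < 1, the rate a can be kept below 1, so the iterates of e_0 grow geometrically. *)
Lemma cesaro_growth_lt1 : exists a K : R, [/\ 0 < a < 1, 0 < K &
  forall j, 1 <= a ^+ j * (K * rnorm (iter j C (delta 0%N)))].
Proof.
have s1 : 0 < 1 - s by rewrite subr_gt0 inv_exponent_lt1.
have r1 : 1 < r by move: p_gt1; rewrite lte_fin.
have sp : 0 < s by rewrite invr_gt0 (lt_trans ltr01).
have c01 : 0 < 1 - s < 1 by rewrite s1 gtrBl.
have [e [e01 ec]] := exists_pos_mul1D_lt1 c01.
have [K K0 HK] := @iter_cesaro_growth e e01 (ltW ec).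
exists ((1 + e) * (1 - s)), K; split => //; rewrite ec andbT mulr_gt0//.
by case/andP: e01 => e0 _; rewrite ltr_wpDl// ler01.
Qed.

Lemma not_power_bounded_cesaro : ~ power_bounded C.
Proof.
have [a [K [/andP[a0 a1] K0 HK]]] := cesaro_growth_lt1.
rewrite /power_bounded; set B := ereal_sup _ => By.
have Bj j : ((rnorm (iter j.+1 C (delta 0%N)))%:E <= B)%E.
  apply: le_trans (op_norm_ge (iter j.+1 C) (_ : rnorm (delta 0%N) <= 1)) _.
    by rewrite rnorm_delta.
  by apply: ereal_sup_ubound; exists j.+1.
have B0 : (0 <= B)%E by apply: le_trans (Bj 0%N); rewrite lee_fin rnorm_ge0.
have BE : B = (fine B)%:E by rewrite fineK// ge0_fin_numE.
pose b := fine B; rewrite -/b in BE.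
have b0 : 0 <= b by rewrite -lee_fin -BE.
have Kb : 0 < K * (b + 1) by rewrite mulr_gt0// ltr_wpDl.
have Kb' : 0 < (K * (b + 1))^-1 by rewrite invr_gt0.
have [N _ HN] := @geometric_small R a (K * (b + 1))^-1
  (introT andP (conj (ltW a0) a1)) Kb'.
have := HN N.+1 (leqnSn _); rewrite /= -(ltr_pM2r Kb) mulVf ?gt_eqF//.
apply/negP; rewrite -leNgt; apply: le_trans (HK N.+1) _.
rewrite ler_wpM2l ?exprn_ge0 ?(ltW a0)// ler_pM2l// ler_wpDr//.
by rewrite -lee_fin -BE.
Qed.

(** Convergent means t_n are bounded, and C_1^(n+1) e_0 = (n+1) t_(n+1) - n t_n would grow at most
    linearly, against the geometric growth. *)
Lemma not_mean_ergodic_cesaro_fin : ~ mean_ergodic C.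
Proof.
have [a [K [a01 K0 HK]]] := cesaro_growth_lt1.
have /andP[a0 a1] := a01.
move=> [P [_ /(_ (delta 0%N))]].
move=> /cvgrPdist_lt/(_ 1 ltr01)[N _ HN].
set v := P (delta 0%N) in HN; pose t n := ergodic_mean C n (delta 0%N).
pose B := rnorm v + 1.
have B0 : 0 < B by rewrite ltr_wpDl ?rnorm_ge0.
have tB n : (N <= n)%N -> rnorm (t n) <= B.
  move=> /HN; rewrite rnormE -/(t n) -[1]/(1%:C) ltcR => /ltW H.
  have -> : t n = v - (v - t n) by rewrite opprB addrC subrK.
  by apply: le_trans (ler_rnormD _ _) _; rewrite rnormN lerD2l.
have tS n : n.+1%:R *: t n.+1 = \sum_(1 <= m < n.+2) iter m C (delta 0%N).
  by rewrite /t /ergodic_mean scalerA divff ?pnatr_eq0// scale1r.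
have Cn n : (N < n)%N -> rnorm (iter n.+1 C (delta 0%N)) <= n.+1%:R * (2 * B).
  case: n => // n Nn.
  have -> : iter n.+2 C (delta 0%N) = n.+2%:R *: t n.+2 - n.+1%:R *: t n.+1.
    by rewrite !tS [X in _ = X - _]big_nat_recr//= [RHS]addrAC subrr add0r.
  apply: le_trans (ler_rnormD _ _) _.
  rewrite rnormN (rnormZ _ (t n.+2)) (rnormZ _ (t n.+1)) !normc_nat.
  have -> : n.+2%:R * (2 * B) = n.+2%:R * B + n.+2%:R * B by ring.
  apply: lerD.
    by apply: ler_wpM2l => //; apply: tB; exact: leq_trans (ltnW Nn) _.
  apply: ler_pM; rewrite ?ler0n ?rnorm_ge0 ?ler_nat//.
  by apply: tB; exact: ltnW.
have [e [/andP[e0 e1] ea]] := exists_pos_mul1D_lt1 a01.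
have x0 : 0 <= (1 + e) * a by rewrite mulr_ge0 ?(ltW a0)// addr_ge0// ltW.
pose D := K * (2 * B) / e.
have D0 : 0 < D by rewrite divr_gt0// !mulr_gt0.
have D'0 : 0 < D^-1 by rewrite invr_gt0.
have [M _ HM] := @geometric_small R ((1 + e) * a) D^-1
  (introT andP (conj x0 ea)) D'0.
pose n := maxn M N.+1.
have := HM n.+1 (leq_trans (leq_maxl _ _) (leqnSn _)).
rewrite /= -(ltr_pM2r D0) mulVf ?gt_eqF//.
apply/negP; rewrite -leNgt; apply: le_trans (HK n.+1) _.
rewrite exprMn [(1 + e) ^+ _ * _]mulrC -mulrA.
rewrite ler_wpM2l ?exprn_ge0 ?(ltW a0)//.
have -> : (1 + e) ^+ n.+1 * D = K * (((1 + e) ^+ n.+1 / e) * (2 * B)).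
  by rewrite /D; ring.
rewrite ler_pM2l//; apply: le_trans (Cn n _) _; first exact: leq_maxr.
by rewrite ler_wpM2r ?natr_le_exp1D// mulr_ge0// ltW.
Qed.

End cesaro_growth.

(** * Failure of compactness for finite p *)

Section cesaro_not_compact_fin.
Set Implicit Arguments.
Unset Strict Implicit.
Context {R : realType} (r : R) (p1 : (1 <= r%:E)%E) (p_gt1 : (1 < r%:E)%E).
Local Notation normc := Normc.normc.
Local Notation C := (@cesaro_op R r%:E p1 p_gt1).

Definition block N (n : nat) : R := if (n <= N)%N then N.+1%:R `^ (- r^-1) else 0.

Lemma block_ge0 N n : 0 <= block N n.
Proof. by rewrite /block; case: ifP => // _; exact: powR_ge0. Qed.

Let r0 : 0 < r.
Proof. by move: p_gt1; rewrite lte_fin; exact: lt_trans. Qed.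

Lemma block_powR N n : block N n `^ r = (n <= N)%:R / N.+1%:R.
Proof.
rewrite /block; case: ifP => _; last by rewrite powR0 ?gt_eqF// mul0r.
by rewrite -powRrM mulNr mulVf ?gt_eqF// powR_inv1// mul1r.
Qed.

Lemma sum_block_powR N M :
  \sum_(n < M) block N n `^ r = (minn M N.+1)%:R / N.+1%:R.
Proof.
elim: M => [|M IH]; first by rewrite big_ord0 min0n mul0r.
rewrite big_ord_recr/= IH block_powR -mulrDl -natrD; congr (_%:R / _).
have [MN|NM] := leqP M N; first by rewrite !(minn_idPl _) ?addn1// ltnW.
by rewrite addn0 !(minn_idPr _)// ltnW.
Qed.

Lemma ell_norm_block_le N : (ell_norm r%:E (fun n => (block N n)%:C) <= 1)%E.
Proof.
apply/(ell_norm_le_fin _ r0 ler01) => M.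
under eq_bigr => n _ do rewrite normcR ger0_norm ?block_ge0//.
by rewrite sum_block_powR powR1 ler_pdivrMr// mul1r ler_nat geq_minr.
Qed.

Lemma block_mem N : (fun n => (block N n)%:C) \in ell_pred p1.
Proof. exact: ell_predE (ell_norm_block_le N). Qed.

Lemma cesaro_block N n : (n <= N)%N -> cesaro_real (block N) n = block N n.
Proof.
move=> nN; rewrite /cesaro_real (eq_bigr (fun=> block N n)) => [|k _].
  by rewrite sumr_const card_ord -[_ *+ _]mulr_natr mulfK.
by rewrite /block nN (leq_trans _ nN)// -ltnS.
Qed.

(** Averaging reproduces a constant block on 0..N, so the image of each unit block has norm at least
    1, while its height (N+1)^(-1/r) tends to 0. *)
Lemma not_compact_cesaro_fin : ~ compact_operator C.
Proof.
have CE N n : (C (Ell (block_mem N)) : ell p1) n = (cesaro_real (block N) n)%:C.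
  by rewrite -[LHS]/(cesaro_seq (fun n => (block N n)%:C) n) cesaro_seq_real.
have nCE N n : (n <= N)%N -> normc (C (Ell (block_mem N)) n) = block N n.
  by move=> nN; rewrite CE cesaro_block// normcR ger0_norm// block_ge0.
apply: (@not_compact_of_vanishing _ _ p1 C (fun N => Ell (block_mem N)) 1) => //.
- by move=> N; rewrite rnorm_le ell_norm_block_le.
- move=> N; rewrite leNgt; apply/negP => H.
  have : (ell_norm r%:E (C (Ell (block_mem N))) <=
      (rnorm (C (Ell (block_mem N))))%:E)%E by rewrite ell_norm_rnorm.
  move=> /(ell_norm_le_fin _ r0 (rnorm_ge0 _))/(_ N.+1).
  rewrite (eq_bigr (fun n : 'I_N.+1 => block N n `^ r)) => [|n _]; last first.
    by rewrite nCE// -ltnS.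
  rewrite sum_block_powR minnn divff ?pnatr_eq0//.
  have E1 : 1 `^ r = 1 :> R by rewrite powR1.
  apply/negP; rewrite -ltNge -[ltRHS]E1.
  by rewrite gt0_ltr_powR// nnegrE// rnorm_ge0.
move=> n e e0; have ri : 0 < r^-1 by rewrite invr_gt0.
have [M HM] := powRN_small ri e0.
near=> N; rewrite nCE; last by near: N; exact: nbhs_infty_ge.
rewrite /block; case: ifP => _; last exact: ltW.
by apply: HM; near: N; exact: nbhs_infty_ge.
Unshelve. all: by end_near. Qed.

End cesaro_not_compact_fin.

(** * The operator on bounded sequences *)

Section cesaro_infty.
Set Implicit Arguments.
Unset Strict Implicit.
Context {R : realType}.
Local Notation normc := Normc.normc.
Let p1 : (1 <= +oo :> \bar R)%E := leey 1%E.
Let p_gt1 : (1 < +oo :> \bar R)%E := ltry 1.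
Local Notation C := (@cesaro_op R +oo%E p1 p_gt1).
Local Notation delta := (ell_delta p1).

Lemma op_norm_cesaro_infty_ge : (1 <= op_norm C)%E.
Proof.
have d1 : rnorm (delta 0%N) <= 1 by rewrite rnorm_delta.
apply: le_trans (op_norm_ge C d1); rewrite lee_fin.
apply: le_trans (normc_coord_le_rnorm _ 0%N).
by rewrite (iter_cesaro0 p_gt1 (delta 0%N) 1) ell_deltaE eqxx Normc.normc1.
Qed.

Lemma ell_norm_tail_le N :
  (ell_norm +oo (fun n => (N <= n)%:R : R[i]) <= 1)%E.
Proof. by apply/ell_norm_le_infty => n; rewrite normc_nat lern1 leq_b1. Qed.

Lemma tail_mem N : (fun n => (N <= n)%:R : R[i]) \in ell_pred p1.
Proof. exact: ell_predE (ell_norm_tail_le N). Qed.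

Lemma sum_tail N M : \sum_(n < M) (N <= n)%:R = (M - N)%:R :> R[i].
Proof.
elim: M => [|M IH]; first by rewrite big_ord0 sub0n.
rewrite big_ord_recr/= IH -natrD; congr _%:R.
have [NM|MN] := leqP N M; first by rewrite subSn// addn1.
by rewrite addn0 (eqP (ltnW MN : M - N == 0)%N) (eqP (MN : M.+1 - N == 0)%N).
Qed.

(** The images of the tail indicators vanish below N, but at index 2N the average is (N+1)/(2N+1) >=
    1/2. *)
Lemma not_compact_cesaro_infty : ~ compact_operator C.
Proof.
have CE N n : (C (Ell (tail_mem N)) : ell p1) n = (n.+1 - N)%:R / n.+1%:R.
  by rewrite -[LHS]/(cesaro_seq (fun n => (N <= n)%:R) n) /cesaro_seq sum_tail.
apply: (@not_compact_of_vanishing _ _ p1 C (fun N => Ell (tail_mem N)) 2^-1) => //.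
- by move=> N; rewrite rnorm_le ell_norm_tail_le.
- move=> N; apply: le_trans (normc_coord_le_rnorm _ N.*2).
  rewrite CE Normc.normcM Normc.normcV !normc_nat ler_pdivlMr// ler_pdivrMl//.
  by rewrite -natrM ler_nat -addnn subSn ?leq_addr// addnK mul2n doubleS -addnn leqnSn.
move=> n e e0; near=> N; rewrite CE.
have -> : (n.+1 - N)%N = 0%N.
  by apply/eqP; rewrite subn_eq0; near: N; exact: nbhs_infty_ge.
by rewrite mul0r Normc.normc0 ltW.
Unshelve. all: by end_near. Qed.

Lemma cesaro_opD (x y : ell p1) : C (x + y) = C x + C y.
Proof. by have := cesaro_op_linear p_gt1 1 x y; rewrite !scale1r. Qed.

Lemma cesaro_opZ (a : R[i]) (x : ell p1) : C (a *: x) = a *: C x.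
Proof.
have C0 : C 0 = 0 by apply: (addrI (C 0)); rewrite -cesaro_opD !addr0.
by have := cesaro_op_linear p_gt1 a x 0; rewrite C0 !addr0.
Qed.

Lemma cesaro_opB (x y : ell p1) : C (x - y) = C x - C y.
Proof. by rewrite cesaro_opD -scaleN1r cesaro_opZ scaleN1r. Qed.

(* The ergodic means of [e_0] converge coordinatewise to the constant sequence
   1, while each of them tends to 0 at infinity. *)
Lemma not_mean_ergodic_cesaro_infty : ~ mean_ergodic C.
Proof.
have C1 (x : ell p1) : rnorm (C x) <= rnorm x.
  by have := rnorm_cesaro_le p_gt1 x; rewrite subr0 invr1 mul1r.
have iter1 j : rnorm (iter j C (delta 0%N)) <= 1.
  by elim: j => [|j IH]; rewrite ?rnorm_delta// iterS (le_trans (C1 _)).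
move=> [P [_ /(_ (delta 0%N)) cP]].
set v := P (delta 0%N) in cP; pose t n := ergodic_mean C n (delta 0%N).
have tv (e : R) : 0 < e -> exists2 N, (0 < N)%N &
    forall n, (N <= n)%N -> rnorm (v - t n) < e.
  move=> e0; have [N _ HN] := proj1 (cvgrPdist_lt _ _) cP _ (ltr0c_real e0).
  exists N.+1 => // n Nn; have := HN n (ltnW Nn).
  by rewrite /= rnormE ltcR.
(* The sum telescopes; since C_1 is a contraction, the difference is at most 2/n in norm, and the
   limit v is a fixed point. *)
have tel n : C (t n) - t n =
    n%:R^-1 *: (iter n.+1 C (delta 0%N) - C (delta 0%N)).
  rewrite /t /ergodic_mean cesaro_opZ -scalerBr; congr (_ *: _).
  elim: n => [|n IH].
    rewrite big_geq// subrr subr0.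
    by apply: (addrI (C 0)); rewrite -cesaro_opD !addr0.
  rewrite big_nat_recr//= cesaro_opD opprD addrACA IH.
  by rewrite addrC addrA subrK.
have telle n : rnorm (C (t n) - t n) <= n%:R^-1 * 2.
  rewrite tel rnormZ Normc.normcV normc_nat ler_wpM2l ?invr_ge0//.
  apply: le_trans (ler_rnormD _ _) _; rewrite rnormN [leRHS]mulr2n.
  by rewrite lerD// ?(iter1 n.+1) ?(iter1 1%N).
have Cv : C v = v.
  apply/eqP; rewrite -subr_eq0; apply/eqP/rnorm_eq0/eqP.
  rewrite eq_le rnorm_ge0 andbT; apply/ler_addgt0Pr => e e0; rewrite add0r.
  have e4 : 0 < e / 4 by rewrite divr_gt0.
  have [N N0 HN] := tv _ e4.
  pose n := maxn N (Num.trunc (4 * e^-1)).+1.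
  have n0 : 0 < n%:R :> R by rewrite ltr0n (leq_trans N0)// leq_maxl.
  have ne : n%:R^-1 * 2 <= e / 2.
    rewrite ler_pdivrMl// mulrC -ler_pdivrMl; last by rewrite divr_gt0.
    have H : 4 * e^-1 <= n%:R.
      by apply/ltW/(lt_le_trans (truncnS_gt _)); rewrite ler_nat leq_maxr.
    by apply: le_trans H; rewrite invfM invrK; lra.
  have Hn := HN n (leq_maxl _ _).
  have -> : C v - v = C (v - t n) + ((C (t n) - t n) - (v - t n)).
    by rewrite opprB [X in _ = _ + X]addrA subrK cesaro_opB addrA subrK.
  apply: le_trans (ler_rnormD _ _) _.
  apply: le_trans (lerD (C1 _) (ler_rnormD _ _)) _.
  rewrite rnormN; have := telle n; lra.
have t0 n : (0 < n)%N -> t n 0%N = 1.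
  move=> n0; rewrite /t /ergodic_mean ell_coordZ ell_coord_sum.
  rewrite (eq_bigr (fun=> 1)) => [|i _]; last by rewrite iter_cesaro0 ell_deltaE eqxx.
  rewrite big_const_nat iter_addr_0 subSS subn0 mulVf//.
  by rewrite pnatr_eq0 -lt0n.
have v0 : v 0%N = 1.
  apply/eqP; rewrite -subr_eq0; apply/eqP/Normc.eq0_normc/eqP.
  rewrite eq_le normc_ge0 andbT; apply/ler_addgt0Pr => e e0; rewrite add0r.
  have [N N0 HN] := tv _ e0.
  apply: le_trans (ltW (HN N (leqnn _))).
  by have := normc_coord_le_rnorm (v - t N) 0%N; rewrite ell_coordB t0.
(* Fixed points of C_1 are constant: (m+2) v_(m+1) = (m+1) v_m + v_(m+1). *)
have v1 m : v m = 1.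
  elim: m => [//|m IH]; have := cesaro_seqS v m.+1.
  have csv k : cesaro_seq v k = v k by rewrite -[in RHS]Cv.
  rewrite !csv /= IH -[m.+2%:R]natr1 mulrDl mul1r mulr1 => /addIr.
  by rewrite -[RHS]mulr1; apply: mulfI; rewrite pnatr_eq0.
(* Fix one mean within 1/2 of v in norm, then take a coordinate m so far out that this mean is at
   most 1/2 there, although v_m = 1. *)
have i2 : 0 < 2^-1 :> R by rewrite invr_gt0.
have [n n0 /(_ n (leqnn _)) Hn] := tv _ i2.
pose h m : R := \sum_(1 <= k < n.+1) iter k cesaro_real (@delta_real R) m.
have hE m : t n m = (n%:R^-1 * h m)%:C.
  rewrite /t /ergodic_mean ell_coordZ ell_coord_sum rmorphM/= fmorphV rmorph_nat.
  rewrite /h rmorph_sum/=; congr (_ * _); apply: eq_bigr => k _.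
  by rewrite iter_cesaro_delta.
have h0 : h @ \oo --> (0 : R).
  rewrite /h; elim: (n.+1) => [|k IH].
    by under eq_fun do rewrite big_geq//; exact: cvg_cst.
  case: k IH => [|k] IH.
    by under eq_fun do rewrite big_geq//; exact: cvg_cst.
  under eq_fun do rewrite big_nat_recr//=.
  have d0 : @delta_real R @ \oo --> (0 : R).
    apply: cvg_near_cst.
    by exists 1%N => // m; rewrite /delta_real /=; case: m.
  have := cvgD IH (cvg_iter_cesaro_real k.+1 d0).
  by rewrite addr0; apply.
have n2 : 0 < n%:R / 2 :> R by rewrite divr_gt0// ltr0n.
have [m _ /(_ m (leqnn _)) Hm] := proj1 (cvgrPdist_lt _ _) h0 _ n2.
have := normc_coord_le_rnorm (v - t n) m.
rewrite ell_coordB v1 hE -(rmorph1 (@real_complex R)) -rmorphB normcR.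
rewrite leNgt => /negP; apply; apply: (lt_le_trans Hn).
apply: le_trans (ler_norm _).
have h_lt : h m < n%:R / 2.
  by apply: le_lt_trans (ler_norm _) _; move: Hm; rewrite /= sub0r normrN.
have : n%:R^-1 * h m <= 2^-1.
  by rewrite ler_pdivrMl ?ltr0n// ltW.
lra.
Qed.

End cesaro_infty.

Theorem proposition4p1 (R : realType) :
  (forall (p p' : R) (p_gt1 : 1 < p), p^-1 + p'^-1 = 1 ->
     exists C1 : ell (exponent_ge1 p_gt1) -> ell (exponent_ge1 p_gt1),
       [/\ bounded_linear C1,
           forall x, C1 x = cesaro_seq x :> (nat -> R[i]),
           op_norm C1 = p'%:E,
           spectrum C1 = [set z | `|z - (p' / 2)%:C| <= (p' / 2)%:C]
         & [/\ ~ compact_operator C1, ~ power_bounded C1,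
               ~ mean_ergodic C1 & ~ supercyclic C1]]) /\
  (exists C1 : ell (@leey R 1%E) -> ell (@leey R 1%E),
     [/\ bounded_linear C1,
         forall x, C1 x = cesaro_seq x :> (nat -> R[i]),
         op_norm C1 = 1%E,
         spectrum C1 = [set z | `|z - (1 / 2)%:C| <= (1 / 2)%:C]
       & [/\ ~ compact_operator C1, ~ mean_ergodic C1 & ~ supercyclic C1]]).
Proof.
split=> [p p' p_gt1 pp'|].
  have p_gt1' : (1 < p%:E)%E by rewrite lte_fin.
  have p'E : p' = (1 - inv_exponent p%:E)^-1.
    by rewrite /= -pp' addrAC subrr add0r invrK.
  exists (@cesaro_op R p%:E (exponent_ge1 p_gt1) p_gt1'); split.
  - exact: cesaro_op_bounded_linear.
  - by [].
  - by apply/eqP; rewrite eq_le p'E op_norm_cesaro_le op_norm_cesaro_ge.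
  - by rewrite spectrum_cesaro p'E.
  - split.
    + exact: not_compact_cesaro_fin.
    + exact: not_power_bounded_cesaro.
    + exact: not_mean_ergodic_cesaro_fin.
    + exact: not_supercyclic_cesaro.
exists (@cesaro_op R +oo%E (leey 1%E) (ltry 1)); split.
- exact: cesaro_op_bounded_linear.
- by [].
- apply/eqP; rewrite eq_le op_norm_cesaro_infty_ge andbT.
  by have := @op_norm_cesaro_le R +oo%E (leey 1%E) (ltry 1); rewrite subr0 invr1.
- by rewrite spectrum_cesaro /= subr0 invr1.
- split.
  + exact: not_compact_cesaro_infty.
  + exact: not_mean_ergodic_cesaro_infty.
  + exact: not_supercyclic_cesaro.
Qed.
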